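(* For every real $\epsilon>0$ there exists $D_0$ such that the following holds for all real $D\ge D_0$. Let $G$ be a finite graph and for each vertex $v\in V(G)$ let $L_v$ be a given finite list (set) of colours. If for each vertex $v\in V(G)$ we have $\frac{1}{|L_v|}\sum_{c\in L_v}d_c(v)\le D$ and $|L_v|\ge (1+\epsilon)D$, then there is a proper list colouring of $G$, i.e. a choice of a colour $\phi(v)\in L_v$ for every $v\in V(G)$ such that $\phi(u)\ne\phi(v)$ for every edge $uv\in E(G)$.
   Context: For a graph $G$ with lists $\{L_v\}_{v\in V(G)}$, a vertex $v$ and a colour $c\in L_v$, the vertex-colour degree $d_c(v)$ is the number of neighbours $u$ of $v$ in $G$ with $c\in L_u$. Graphs are finite and simple. *)

(* Defs.v *)
From HB Require Import structures.
From mathcomp Require Import all_boot all_order all_algebra finmap.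

Set Implicit Arguments.
Unset Strict Implicit.
Unset Printing Implicit Defensive.

Import Order.TTheory GRing.Theory Num.Theory.

Local Open Scope fset_scope.
Local Open Scope ring_scope.

(* A simple graph on a finite vertex type [V] is an adjacency relation
   [e : rel V]. *)
Definition simple_graph (V : finType) (e : rel V) : Prop :=
  symmetric e /\ irreflexive e.

Definition vertex_colour_degree (V : finType) (e : rel V) (C : choiceType)
    (L : V -> {fset C}) (v : V) (c : C) : nat :=
  #|[set u : V | e v u & c \in L u]|.

Definition average_colour_degree (R : realFieldType) (V : finType) (e : rel V)
    (C : choiceType) (L : V -> {fset C}) (v : V) : R :=
  (#|` L v|%:R)^-1 * \sum_(c <- L v) (vertex_colour_degree e L v c)%:R.

Definition proper_list_colouring (V : finType) (e : rel V) (C : choiceType)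
    (L : V -> {fset C}) (phi : V -> C) : Prop :=
  (forall v, phi v \in L v) /\ (forall u v, e u v -> phi u <> phi v).

(* Main.v *)
Require Import Defs.
From HB Require Import structures.
From mathcomp Require Import all_boot all_order all_algebra finmap reals.
From mathcomp Require Import sequences exp.
From mathcomp Require Import lra ring.

Set Implicit Arguments.
Unset Strict Implicit.
Unset Printing Implicit Defensive.

Import Order.TTheory GRing.Theory Num.Theory.

Local Open Scope ring_scope.

(** The colouring is built by a nibble. Let all lists have length [l] and let
the colours in each list have average degree at most [D]. Every vertex [u]
tries every colour [c] of its list independently with probability [p = th / l].
If no two adjacent vertices try the same colour of both lists, then each vertex
that tried something can keep one of the colours it tried, and every other
vertex deletes from its list the colours tried by its neighbours. In
expectation a list loses at most [th * D] colours, and about a proportion [th]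
of the neighbours of each vertex gets coloured, so that [D] drops by about
[th * D] too. The gap between [l] and [D] is thus preserved up to errors of
order [th ^+ 2 * D], while [D] decreases geometrically. Once [D] is a small
fraction of [l], one application of the local lemma colours all remaining
vertices ([list_colourable_of_long_lists]).

An average bound on the degrees is enough because high-degree colours are
deleted more often: a colour of degree [d] survives with probability
[(1 - p) ^+ d], so by Chebyshev's sum inequality the survivors have
average degree at most [D] in expectation ([mean_excess_le0]). This needs the
survival probability to be a function of the degree alone, hence lists of equal
length; after each round the lists are cut to a common length by discarding
colours of largest degree ([subset_small_average]). A first cut of the same
kind, paid by part of the surplus [eps * D], also bounds all degrees by a
constant multiple of the initial average, and later rounds do not increase any
degree.

A round succeeds with positive probability by the asymmetric local lemma
([random_step]). The deviations to be avoided concern weighted counts of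
blocks of coordinates on which all trials failed; these are sums of
independent variables and concentrate exponentially well ([block_tail]):
with [N] the initial average degree, a deviation has probability at most
[exp (- c * th * N)]. A deviation event meets conflict events of total weight
of order [th ^+ 2 * N], and this is affordable as soon as [th] is small
compared to [c]. Degrees are controlled for each vertex and colour separately:
a vertex may have about [N ^+ 2] neighbours, too many for one event, but only
a constant multiple of [N] of them share a given colour with it.

The invariant [(1 + a) * D + a * N <= l] absorbs the errors: what a round loses
on [l - D] is less than the decrease of [a * D] ([nibble_round]). *)

(** * Elementary inequalities *)

Lemma ler_prod_sub (R : realDomainType) (J : finType) (P Q : pred J)
    (f : J -> R) :
  (forall k, 0 <= f k <= 1) -> (forall k, Q k -> P k) ->
  \prod_(k | P k) f k <= \prod_(k | Q k) f k.
Proof.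
move=> f01 QP; rewrite (bigID Q) /= (eq_bigl Q) => [|k]; last first.
  by case Qk: (Q k); rewrite ?andbF // QP.
apply: ler_piMr; first by apply: prodr_ge0 => k _; case/andP: (f01 k).
by apply: prodr_ile1 => k _.
Qed.

(** In the local lemma the total weight of the events that share a coordinate
with a given one is bounded by adding up, over the coordinates of this event,
the weights of the events that use the coordinate. *)
Lemma sum_meet_le (R : realDomainType) (I J : finType) (S : {set I})
    (T : J -> {set I}) (x : J -> R) : (forall k, 0 <= x k) ->
  \sum_(k | ~~ [disjoint S & T k]) x k
    <= \sum_(i in S) \sum_(k | i \in T k) x k.
Proof.
move=> x0; rewrite (exchange_big_dep predT) //=.
rewrite big_mkcond; apply: ler_sum => k _.
case: ifP => [/pred0Pn[i /= /andP[iS iT]]|_]; last exact: sumr_ge0.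
by rewrite (bigD1 i) /= ?iS // lerDl sumr_ge0.
Qed.

(** Any [k]-subset of least total value consists of elements that are not
larger than the discarded ones, which gives both bounds. The second one turns a
bound on the average into a bound on each kept value as soon as a fixed
proportion of the elements is discarded. *)
Lemma subset_small_average (R : realFieldType) (C : finType) (A : {set C})
    (f : C -> R) (D : R) (k : nat) :
  (forall c, 0 <= f c) -> (k <= #|A|)%N -> \sum_(c in A) f c <= D * #|A|%:R ->
  exists B : {set C}, [/\ B \subset A, #|B| = k, \sum_(c in B) f c <= D * k%:R
    & forall c, c \in B -> f c * (#|A|%:R - k%:R) <= D * #|A|%:R].
Proof.
move=> f0 kA sumA.
pose P (B : {set C}) := (B \subset A) && (#|B| == k).
have [B0 PB0] : exists B0, P B0.
  have : (0 < #|[set B : {set C} | P B]|)%N by rewrite cards_draws bin_gt0.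
  by case/card_gt0P => B0; rewrite inE; exists B0.
pose B := [arg min_(B < B0 | P B) (\sum_(c in B) f c)]%O.
have [PB minB] : P B /\ forall B', P B' ->
    \sum_(c in B) f c <= \sum_(c in B') f c.
  by rewrite /B; case: Order.TotalTheory.arg_minP.
have /andP[BA /eqP cardB] := PB.
have Bmin b a : b \in B -> a \in A :\: B -> f b <= f a.
  move=> bB /setDP[aA aB].
  have aBb : a \notin B :\ b by apply: contra aB => /setD1P[].
  have := minB (a |: (B :\ b)).
  rewrite (big_setD1 b bB) big_setU1 //= lerD2r; apply.
  rewrite /P cardsU1 aBb -cardB (cardsD1 b B) bB eqxx andbT.
  by rewrite subUset sub1set aA (subset_trans (subsetDl _ _)).
have cardAB : #|A :\: B|%:R = #|A|%:R - k%:R :> R.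
  by rewrite cardsD (setIidPr BA) cardB natrB.
have sumAB : \sum_(c in A) f c = \sum_(c in B) f c + \sum_(c in A :\: B) f c.
  by rewrite (big_setID B) (setIidPr BA).
have sumB0 : 0 <= \sum_(c in B) f c by apply: sumr_ge0.
exists B; split=> // [|b bB]; last first.
  rewrite -cardAB; apply: le_trans sumA; rewrite sumAB.
  rewrite mulr_natr -sumr_const; apply: ler_wpDl => //.
  by apply: ler_sum => a; apply: Bmin.
have [A0|A0] := posnP #|A|.
  move: kA; rewrite A0 leqn0 => /eqP k0.
  by rewrite k0 mulr0 big_pred0 // => c; rewrite (cards0_eq (etrans cardB k0)) inE.
have An : 0 < #|A|%:R :> R by rewrite ltr0n.
rewrite -(ler_pM2r An) mulrAC.
have swap : (\sum_(c in B) f c) * #|A :\: B|%:R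
    <= k%:R * \sum_(c in A :\: B) f c.
  rewrite -cardB mulr_suml mulr_natl -[leRHS]sumr_const; apply: ler_sum => b bB.
  by rewrite mulr_natr -sumr_const; apply: ler_sum => a; apply: Bmin.
have k0 : 0 <= k%:R :> R by [].
move: swap sumA; rewrite cardAB sumAB; nra.
Qed.

Lemma expRN2_le (R : realType) (x : R) : 0 <= x -> x <= 2^-1 ->
  expR (- (2 * x)) <= 1 - x.
Proof.
move=> x0 x1; rewrite expRN.
have e1 := expR_ge1Dx (2 * x).
have h1 : 0 < 1 + 2 * x by lra.
apply: (@le_trans _ _ (1 + 2 * x)^-1).
  by rewrite lef_pV2 // posrE // (lt_le_trans h1).
by rewrite -[X in X <= _]mul1r ler_pdivrMr //; nra.
Qed.

Lemma expR_le_quad (R : realType) (z : R) : z <= 2^-1 ->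
  expR z <= 1 + z + 2 * z ^+ 2.
Proof.
move=> z1; have e1 := expR_ge1Dx (- z).
have h1 : 0 < 1 + - z by lra.
rewrite -[z in leLHS]opprK expRN.
apply: (@le_trans _ _ (1 + - z)^-1).
  by rewrite lef_pV2 // posrE // (lt_le_trans h1).
rewrite -[leLHS]mul1r ler_pdivrMr //.
have : 0 <= z ^+ 2 * (1 - 2 * z) by rewrite mulr_ge0 ?sqr_ge0 //; lra.
nra.
Qed.

(** The exponent carries the probability [r] of failure, as in Bernstein's
inequality. The failures counted in a round have probability of order [th], and
Hoeffding's inequality, which ignores it, would only control deviations of the
size of the drop itself. *)
Lemma bernoulli_mgf_le (R : realType) (r y : R) : 0 <= r -> `|y| <= 2^-1 ->
  (1 - r) * expR (y * r) + r * expR (y * (r - 1)) <= expR (2 * r * y ^+ 2).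
Proof.
move=> r0 y1.
have -> : (1 - r) * expR (y * r) + r * expR (y * (r - 1))
    = expR (y * r) * (1 + r * (expR (- y) - 1)).
  by rewrite mulrBr mulr1 expRD; ring.
apply: (@le_trans _ _ (expR (y * r) * expR (r * (expR (- y) - 1)))).
  by rewrite ler_wpM2l ?expR_ge0 ?expR_ge1Dx.
rewrite -expRD ler_expR.
have := @expR_le_quad _ (- y).
rewrite sqrrN => /(_ _)/wrap[|h]; first by move: y1; rewrite ler_norml; lra.
nra.
Qed.

Lemma expR1_le4 (R : realType) : expR 1 <= 4 :> R.
Proof.
have e2 : expR (2^-1) <= 2 :> R.
  by apply: le_trans (expR_le_quad _) _ => //; lra.
rewrite (_ : 1 = 2^-1 + 2^-1) ?expRD; last by lra.
have := expR_ge0 (2^-1 : R); nra.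
Qed.

Lemma expRN_half (R : realType) : 2^-1 <= expR (- 2^-1) :> R.
Proof. by apply: le_trans (expR_ge1Dx _); lra. Qed.

(** The fifth power beats the total weight of the deviations met by one of
them, which grows like [N ^+ 4] apart from its exponential factor. *)
Lemma expR_ge_quintic (R : realType) (x : R) : 0 <= x ->
  (x / 5) ^+ 5 <= expR x.
Proof.
move=> x0; rewrite [in leRHS](_ : x = 5 * (x / 5)); last first.
  by rewrite mulrC divfK // pnatr_eq0.
have x5 : 0 <= x / 5 by rewrite divr_ge0.
rewrite expRM_natl lerXn2r ?nnegrE ?expR_ge0 //.
by apply: le_trans (expR_ge1Dx _); rewrite lerDr.
Qed.

Lemma exprn_1subr_le (R : realFieldType) (q : R) n : 0 <= q -> q <= 1 ->
  (1 - q) ^+ n <= (1 + q * n%:R)^-1.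
Proof.
move=> q0 q1.
have qn : 0 < 1 + q * n%:R by rewrite ltr_pwDl // mulr_ge0.
rewrite -[leRHS]mul1r ler_pdivlMr //.
elim: n qn => [|n IHn] _; first by rewrite expr0 mulr0 addr0 mulr1.
have qn : 0 <= q * n%:R by rewrite mulr_ge0.
have {}IHn := IHn (ltr_pwDl ltr01 qn).
rewrite exprSr -natr1; apply: le_trans IHn.
rewrite -mulrA ler_wpM2l ?exprn_ge0 ?subr_ge0 //; nra.
Qed.

Lemma exprn_1subr_ge (R : realFieldType) (q : R) n : 0 <= q -> q <= 1 ->
  1 - (1 - q) ^+ n <= q * n%:R.
Proof.
move=> q0 q1; elim: n => [|n IHn]; first by rewrite expr0 subrr mulr0.
have h0 : 0 <= (1 - q) ^+ n by rewrite exprn_ge0 // subr_ge0.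
have h1 : (1 - q) ^+ n <= 1 by rewrite exprn_ile1 // ?subr_ge0 // gerBl.
rewrite exprSr -natr1; nra.
Qed.

(** * Product Bernoulli space *)

Section BernoulliSpace.

Variables (R : realType) (I : finType) (p : R).
Hypotheses (p_ge0 : 0 <= p) (p_le1 : p <= 1).

Implicit Types (w : {ffun I -> bool}) (f g : {ffun I -> bool} -> R).
Implicit Types (A B : pred {ffun I -> bool}) (S T : {set I}).

Definition weight w : R := \prod_i (if w i then p else 1 - p).

Definition expect f : R := \sum_w weight w * f w.

Definition prob A : R := expect (fun w => (A w)%:R).

Definition depends_on (X : Type) S (f : {ffun I -> bool} -> X) : Prop :=
  forall w w', {in S, w =1 w'} -> f w = f w'.

Lemma weight_ge0 w : 0 <= weight w.
Proof. by apply: prodr_ge0 => i _; case: (w i) => //; rewrite subr_ge0. Qed.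

Lemma expect_prod_coord (g : I -> bool -> R) :
  expect (fun w => \prod_i g i (w i))
    = \prod_i (p * g i true + (1 - p) * g i false).
Proof.
transitivity (\sum_(w : {ffun I -> bool})
    \prod_i ((if w i then p else 1 - p) * g i (w i))).
  by apply: eq_bigr => w _; rewrite big_split.
rewrite -(bigA_distr_bigA (fun i b => (if b then p else 1 - p) * g i b)).
by apply: eq_bigr => i _; rewrite big_bool.
Qed.

Lemma sum_weight : \sum_w weight w = 1.
Proof.
transitivity (expect (fun w => \prod_(i : I) 1)).
  by apply: eq_bigr => w _; rewrite big1_eq mulr1.
rewrite (expect_prod_coord (fun _ _ => 1)) big1 // => i _.
by rewrite !mulr1 addrC subrK.
Qed.

Lemma expect_cst c : expect (fun=> c) = c.
Proof. by rewrite /expect -mulr_suml sum_weight mul1r. Qed.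

Lemma eq_expect f g : f =1 g -> expect f = expect g.
Proof. by move=> fg; apply: eq_bigr => w _; rewrite fg. Qed.

Lemma le_expect f g : (forall w, f w <= g w) -> expect f <= expect g.
Proof. by move=> fg; apply: ler_sum => w _; rewrite ler_wpM2l ?weight_ge0. Qed.

Lemma expectZ c f : expect (fun w => c * f w) = c * expect f.
Proof. by rewrite /expect mulr_sumr; apply: eq_bigr => w _; rewrite mulrCA. Qed.

Lemma expectD f g : expect (fun w => f w + g w) = expect f + expect g.
Proof. by rewrite /expect -big_split; apply: eq_bigr => w _; rewrite mulrDr. Qed.

Lemma eq_prob A B : A =1 B -> prob A = prob B.
Proof. by move=> AB; apply: eq_expect => w; rewrite AB. Qed.

Lemma prob_ge0 A : 0 <= prob A.
Proof. by rewrite -[X in X <= _](expect_cst 0) le_expect. Qed.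

Lemma le_prob A B : (forall w, A w -> B w) -> prob A <= prob B.
Proof.
move=> AB; apply: le_expect => w; rewrite ler_nat.
by case: (A w) (AB w) => // /(_ isT) ->.
Qed.

Lemma prob0 : prob pred0 = 0.
Proof. exact: expect_cst. Qed.

Lemma prob_setU A B : prob (predU A B) <= prob A + prob B.
Proof.
rewrite /prob -expectD; apply: le_expect => w /=.
by rewrite -natrD ler_nat; case: (A w); case: (B w).
Qed.

Lemma prob_diff A B : prob (fun w => A w && ~~ B w)
   = prob A - prob (fun w => A w && B w).
Proof.
apply/eqP; rewrite eq_sym subr_eq -expectD; apply/eqP/eq_expect => w.
by case: (A w); case: (B w) => //=; rewrite ?addr0 ?add0r.
Qed.

Lemma prob_gt0_ex A : 0 < prob A -> exists w, A w.
Proof.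
move=> A_gt0; have [|/existsPn nA] := boolP [exists w, A w].
  by move/existsP.
move: A_gt0; rewrite (@eq_prob _ pred0) ?prob0 ?ltxx // => w.
exact/negbTE/nA.
Qed.

Definition splice S w w' : {ffun I -> bool} :=
  [ffun i => if i \in S then w i else w' i].

(** Exchanging the coordinates outside [S] of two independent samples preserves
their joint law, and turns [f w * g w'] into a function of one sample. *)
Lemma expect_indep S T f g : [disjoint S & T] ->
  depends_on S f -> depends_on T g ->
  expect (fun w => f w * g w) = expect f * expect g.
Proof.
move=> dST fS gT.
pose swap (x : {ffun I -> bool} * {ffun I -> bool}) :=
  (splice S x.1 x.2, splice S x.2 x.1).
have swapK : involutive swap.
  move=> [w w']; congr (_, _); apply/ffunP => i; rewrite !ffunE /=;
  by case: (i \in S).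
have -> : expect f * expect g
    = \sum_x weight x.1 * weight x.2 * (f x.1 * g x.2).
  rewrite [RHS](eq_bigr (fun x => (weight x.1 * f x.1) * (weight x.2 * g x.2))).
    by rewrite big_distrlr /= pair_big.
  by move=> x _; rewrite mulrACA.
rewrite (reindex_inj (inv_inj swapK)) /=.
transitivity (\sum_x weight x.1 * weight x.2 * (f x.1 * g x.1)).
  rewrite -[LHS]mulr1 -sum_weight big_distrlr /= pair_big /=.
  by apply: eq_bigr => -[w w'] _ /=; rewrite mulrAC.
apply: eq_bigr => -[w w'] _ /=; congr (_ * (_ * _)).
- rewrite /weight -!big_split; apply: eq_bigr => i _; rewrite !ffunE /=.
  by case: (i \in S) => //; rewrite mulrC.
- by apply: fS => i iS; rewrite ffunE iS.
- apply: gT => i iT; rewrite ffunE ifN //.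
  by apply: contraL iT => iS; rewrite (disjointFr dST).
Qed.

Lemma prob_indep S T A B : [disjoint S & T] ->
  depends_on S A -> depends_on T B ->
  prob (fun w => A w && B w) = prob A * prob B.
Proof.
move=> dST AS BT; rewrite /prob -(expect_indep dST).
- by apply: eq_expect => w; rewrite -mulnb natrM.
- by move=> w w' /AS ->.
- by move=> w w' /BT ->.
Qed.

Definition none_in S w := [forall i in S, ~~ w i].

Lemma depends_none_in S : depends_on S (none_in S).
Proof. by move=> w w' ww'; apply: eq_forallb_in => i /ww' ->. Qed.

Lemma prob_none_in S : prob (none_in S) = (1 - p) ^+ #|S|.
Proof.
pose g i b : R := (~~ ((i \in S) && b))%:R.
transitivity (expect (fun w => \prod_i g i (w i))).
  apply: eq_expect => w; rewrite -natr_prod; congr _%:R.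
  have [/'forall_implyP wS|/forallPn[i]] := boolP (none_in S w).
    rewrite big1 // => i _; have [iS|//] := boolP (i \in S).
    by rewrite (wS i iS).
  rewrite negb_imply negbK => /andP[iS wi].
  by rewrite (bigD1 i) //= iS wi.
rewrite (expect_prod_coord g) /g -prodr_const [RHS]big_mkcond /=.
apply: eq_bigr => i _; case: (i \in S) => /=.
  by rewrite mulr0 add0r mulr1.
by rewrite !mulr1 addrC subrK.
Qed.

Lemma prob_both i j : i != j -> prob (fun w => w i && w j) = p ^+ 2.
Proof.
have one k : prob (fun w => w k) = p.
  rewrite (_ : prob _ = 1 - prob (none_in [set k])).
    by rewrite prob_none_in cards1 expr1 opprB addrC subrK.
  apply/eqP; rewrite eq_sym subr_eq -expectD -[X in X == _](expect_cst 1).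
  apply/eqP/eq_expect => w; rewrite -natrD.
  suff -> : (w k + none_in [set k] w)%N = 1%N by [].
  case: (boolP (none_in _ w)) => [/'forall_implyP/(_ k (set11 k))/negbTE->//|].
  by case/forallPn => x; rewrite in_set1 negb_imply negbK => /andP[/eqP-> ->].
move=> ij; rewrite expr2 -{1}(one i) -(one j).
apply: (@prob_indep [set i] [set j]).
- by rewrite disjoints1 in_set1.
- by move=> w w' ww'; rewrite ww' ?set11.
- by move=> w w' ww'; rewrite ww' ?set11.
Qed.

End BernoulliSpace.

(** * Local lemma *)

Section LocalLemma.

Variables (R : realType) (I : finType) (p : R).
Hypotheses (p_ge0 : 0 <= p) (p_le1 : p <= 1).
Variables (J : finType) (A : J -> pred {ffun I -> bool}) (S : J -> {set I}).
Hypothesis depA : forall j, depends_on (S j) (A j).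

Implicit Types (T X Y : {set J}) (w : {ffun I -> bool}).
Local Notation prob := (prob p).

Definition avoids T w := [forall j in T, ~~ A j w].

Lemma depends_avoids T : depends_on (\bigcup_(j in T) S j) (avoids T).
Proof.
move=> w w' ww'; apply: eq_forallb_in => j jT; congr (~~ _).
by apply: depA => i iS; apply: ww'; apply/bigcupP; exists j.
Qed.

Lemma avoidsU1 k X w : avoids (k |: X) w = avoids X w && ~~ A k w.
Proof.
apply/'forall_implyP/andP => [kX|[/'forall_implyP aX kw] j].
  split; last by apply: kX; rewrite setU11.
  by apply/'forall_implyP => j jX; apply: kX; rewrite setU1r.
by rewrite in_setU1 => /predU1P[->|/aX].
Qed.

Variable x : J -> R.
Hypothesis x_le1 : forall j, x j <= 1.

(** Including the events one at a time, each inclusion keeps a proportion at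
least [1 - x k] of the probability of avoiding the previous ones. *)
Lemma prob_avoids_grow T :
    (forall X k, X \proper T -> k \notin X ->
       prob (fun w => avoids X w && A k w) <= x k * prob (avoids X)) ->
  forall X, X \subset T ->
    \prod_(k in T :\: X) (1 - x k) * prob (avoids X) <= prob (avoids T).
Proof.
move=> IH X; have [n] := ubnP #|T :\: X|; elim: n X => // n IHn X ltn XT.
have [TX0|[k kTX]] := set_0Vmem (T :\: X).
  rewrite TX0 big_set0 mul1r (_ : X = T) //.
  by apply/eqP; rewrite eqEsubset XT -setD_eq0 TX0 eqxx.
have [kT kX] := setDP kTX.
rewrite (big_setD1 k kTX) /= mulrAC.
have -> : (T :\: X) :\ k = T :\: (k |: X).
  by apply/setP => j; rewrite !inE negb_or andbA.
apply: (@le_trans _ _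
   (\prod_(i in T :\: (k |: X)) (1 - x i) * prob (avoids (k |: X)))).
  rewrite mulrC ler_wpM2l //; first by apply: prodr_ge0 => i _; rewrite subr_ge0.
  rewrite (eq_prob p (avoidsU1 k X)) prob_diff mulrBl mul1r lerD2l lerN2.
  apply: IH => //; rewrite properE XT; apply/subsetPn; by exists k.
apply: IHn; last by rewrite subUset sub1set kT.
rewrite (leq_trans _ (_ : #|T :\: X| <= n)%N) //.
apply: proper_card; rewrite properE; apply/andP; split.
  by apply/subsetP => j; rewrite !inE negb_or => /andP[/andP[_ ->]].
by apply/subsetPn; exists k => //; rewrite !inE eqxx.
Qed.

Hypothesis x_ge0 : forall j, 0 <= x j.
Hypothesis A_small : forall j,
  prob (A j) <= x j * \prod_(k | (k != j) && ~~ [disjoint S j & S k]) (1 - x k).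

(** The events of [T] that share no coordinate with [A j] are independent of
it; by induction, conditioning on the avoidance of the others costs at most the
product of the factors [1 - x k], which [A_small] has put aside. *)
Lemma prob_avoids_cond T j : j \notin T ->
  prob (fun w => avoids T w && A j w) <= x j * prob (avoids T).
Proof.
have [n] := ubnP #|T|; elim: n T j => // n IHn T j ltTn jT.
pose T2 := [set k in T | [disjoint S j & S k]].
have T2T : T2 \subset T by apply/subsetP => k; rewrite inE => /andP[].
have grow : \prod_(k in T :\: T2) (1 - x k) * prob (avoids T2)
    <= prob (avoids T).
  apply: prob_avoids_grow => // X k XT kX; apply: IHn => //.
  by rewrite (leq_trans (proper_card XT)).
apply: (@le_trans _ _ (prob (fun w => avoids T2 w && A j w))).
  apply: (le_prob p_ge0 p_le1) => w /andP[/'forall_implyP aT ->]; rewrite andbT.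
  by apply/'forall_implyP => k /(subsetP T2T)/aT.
rewrite (prob_indep p (S := \bigcup_(k in T2) S k) (T := S j)) //; first last.
- exact: depends_avoids.
- rewrite disjoint_sym; apply/bigcup_disjointP => k;
  by rewrite inE => /andP[].
have T2_ge0 : 0 <= prob (avoids T2) by apply: prob_ge0.
rewrite mulrC; apply: le_trans (ler_wpM2r T2_ge0 (A_small j)) _.
rewrite -mulrA ler_wpM2l //; apply: le_trans grow; rewrite ler_wpM2r //.
apply: ler_prod_sub => k; first by rewrite subr_ge0 x_le1 gerBl x_ge0.
rewrite !inE => /andP[]; case kT: (k \in T) => //= ->; rewrite andbT.
by move=> _; apply: contraNneq jT => <-.
Qed.

(** The asymmetric Lovasz local lemma, with dependencies read off the sets of
coordinates. *)
Lemma local_lemma : (forall j, x j < 1) -> exists w, forall j, ~~ A j w.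
Proof.
move=> x_lt1.
have : 0 < prob (avoids setT).
  apply: lt_le_trans (@prob_avoids_grow setT _ _ (sub0set _)).
    rewrite (_ : prob _ = 1).
      by rewrite mulr1; apply: prodr_gt0 => i _; rewrite subr_gt0.
    rewrite -[RHS](expect_cst I p 1); apply: eq_expect => w.
    rewrite (_ : avoids _ _) //; apply/'forall_implyP => j.
    by rewrite inE.
  by move=> X k _; apply: prob_avoids_cond.
case/prob_gt0_ex => w /'forall_implyP aw; exists w => j.
by apply: aw; rewrite inE.
Qed.

End LocalLemma.

Section ExpLocalLemma.

Variables (R : realType) (I : finType) (p : R).
Hypotheses (p_ge0 : 0 <= p) (p_le1 : p <= 1).

(** The exponential form makes the condition additive in the weights, so that
they can be summed coordinate by coordinate. *)
Lemma exp_local_lemma (J : finType) (A : J -> pred {ffun I -> bool})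
    (S : J -> {set I}) (x : J -> R) :
  (forall j, depends_on (S j) (A j)) ->
  (forall j, 0 <= x j) -> (forall j, x j <= 2^-1) ->
  (forall j, prob p (A j) <= x j * expR (- (2 *
      \sum_(k | (k != j) && ~~ [disjoint S j & S k]) x k))) ->
  exists w, forall j, ~~ A j w.
Proof.
move=> depA x0 x1 A_small.
have h : (2^-1 : R) < 1 by lra.
apply: (local_lemma p_ge0 p_le1 depA (x := x)) => // j; last first.
- exact: le_lt_trans h.
- apply: le_trans (A_small j) _; rewrite ler_wpM2l // mulr_sumr -sumrN expR_sum.
  by apply: ler_prod => k _; rewrite expR_ge0 expRN2_le.
- exact/ltW/(le_lt_trans _ h).
Qed.

End ExpLocalLemma.

(** * Concentration of weighted counts of untouched blocks *)

Section BlockConcentration.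

Variables (R : realType) (I : finType) (p : R).
Hypotheses (p_ge0 : 0 <= p) (p_le1 : p <= 1).
Variables (J : finType) (B : J -> {set I}).

Implicit Types (X : {set J}) (w : {ffun I -> bool}).
Local Notation prob := (prob p).
Local Notation expect := (expect p).

Lemma expect_prod_blocks X (f : J -> {ffun I -> bool} -> R) :
  (forall j, depends_on (B j) (f j)) ->
  {in X &, forall j k, j != k -> [disjoint B j & B k]} ->
  expect (fun w => \prod_(j in X) f j w) = \prod_(j in X) expect (f j).
Proof.
move=> depf; have [n] := ubnP #|X|; elim: n X => // n IHn X ltXn dis.
have [->|[k kX]] := set_0Vmem X.
  rewrite big_set0 -[RHS](expect_cst I p); apply: eq_expect => w.
  by rewrite big_set0.
rewrite (big_setD1 k kX) /= -IHn; first last.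
- by move=> i j /setD1P[_ iX] /setD1P[_ jX]; apply: dis.
- by move: ltXn; rewrite (cardsD1 k X) kX.
rewrite -(expect_indep p (S := B k) (T := \bigcup_(j in X :\ k) B j)) //.
- by apply: eq_expect => w; rewrite (big_setD1 k kX).
- apply/bigcup_disjointP => j /setD1P[jk jX].
  by apply: dis; rewrite // eq_sym.
- move=> w w' ww'; apply: eq_bigr => j jX; apply: depf => i iS.
  by apply: ww'; apply/bigcupP; exists j.
Qed.

Variable (X : {set J}).
Hypothesis disB : {in X &, forall j k, j != k -> [disjoint B j & B k]}.

(** Chernoff's method: the blocks are disjoint, hence the exponential moments
multiply. The parameter [lam] is left free because the useful choice depends on
the scale of the weights [a]. *)
Lemma block_tail (a : J -> R) (lam t : R) :
  0 <= lam -> (forall j, j \in X -> `|lam * a j| <= 2^-1) ->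
  prob (fun w => \sum_(j in X) a j * (1 - p) ^+ #|B j| + t
                 <= \sum_(j in X) a j * (none_in (B j) w)%:R)
  <= expR (2 * lam ^+ 2 *
           \sum_(j in X) (1 - (1 - p) ^+ #|B j|) * a j ^+ 2 - lam * t).
Proof.
move=> lam0 lama.
pose q j := (1 - p) ^+ #|B j|.
have q01 j : 0 <= q j <= 1.
  have hp0 : 0 <= 1 - p by rewrite subr_ge0.
  have hp1 : 1 - p <= 1 by rewrite gerBl.
  by rewrite /q exprn_ge0 // exprn_ile1.
pose f j w := if j \in X then
  expR (lam * (a j * ((none_in (B j) w)%:R - q j))) else 1.
have f_dep j : depends_on (B j) (f j).
  by move=> w w' ww'; rewrite /f (depends_none_in ww').
have Ef j : j \in X ->
    expect (f j) <= expR (2 * lam ^+ 2 * ((1 - q j) * a j ^+ 2)).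
  move=> jX; rewrite /f jX.
  apply: le_trans (_ : _ <= expR (2 * (1 - q j) * (lam * a j) ^+ 2)) _;
    last by rewrite ler_expR; nra.
  apply: le_trans _ (@bernoulli_mgf_le _ (1 - q j) (lam * a j) _ (lama j jX)).
  2: by have := q01 j; lra.
  set K := none_in (B j).
  rewrite (@eq_expect _ _ _ _ (fun w =>
     (expR (lam * a j * (1 - q j)) - expR (lam * a j * (1 - q j - 1)))
        * (K w)%:R + expR (lam * a j * (1 - q j - 1)))); last first.
    move=> w; case: (K w); rewrite ?mulr1 ?mulr0 ?subrK ?add0r ?mulrA //.
    by congr expR; ring.
  rewrite expectD expectZ expect_cst -/(prob K) prob_none_in -/(q j).
  by rewrite le_eqVlt; apply/orP; left; apply/eqP; ring.
have -> : expR (2 * lam ^+ 2 * (\sum_(j in X) (1 - q j) * a j ^+ 2) - lam * t)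
  = expR (- (lam * t)) *
    \prod_(j in X) expR (2 * lam ^+ 2 * ((1 - q j) * a j ^+ 2)).
  by rewrite -expR_sum -expRD -mulr_sumr addrC.
apply: (@le_trans _ _ (expR (- (lam * t)) * expect (fun w => \prod_(j in X) f j w)));
  last first.
  rewrite ler_wpM2l ?expR_ge0 // expect_prod_blocks //.
  apply: ler_prod => j jX; rewrite Ef // andbT.
  rewrite -[leLHS](expect_cst I p) le_expect // => w.
  by rewrite /f; case: ifP; rewrite ?expR_ge0.
rewrite -expectZ; apply: le_expect => // w.
have -> : \prod_(j in X) f j w
    = \prod_(j in X) expR (lam * (a j * ((none_in (B j) w)%:R - q j))).
  by apply: eq_bigr => j jX; rewrite /f jX.
rewrite -expR_sum -expRD -mulr_sumr.
case h: (\sum_(j in X) _ + t <= _); last exact: expR_ge0.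
rewrite -[leLHS]expR0 ler_expR.
rewrite addrC -mulrBr mulr_ge0 // subr_ge0.
rewrite -(lerD2l (\sum_(j in X) a j * (1 - p) ^+ #|B j|)).
apply: le_trans h _; rewrite -big_split /=.
by apply: ler_sum => j _; rewrite mulrBr addrC subrK.
Qed.

End BlockConcentration.

(** * Local lemma with colour conflicts *)

Section ColourDegrees.

Variables (V C : finType) (e : rel V).
Hypotheses (e_sym : symmetric e) (e_irr : irreflexive e).

Definition colour_nbrs (L : V -> {set C}) v c := [set u | e v u & c \in L u].

Section ConflictLocalLemma.

Variables (R : realType) (p : R).
Hypotheses (p_ge0 : 0 <= p) (p_le1 : p <= 1).
Variable L : V -> {set C}.

Local Notation sample := {ffun V * C -> bool}.

Definition conflict_at (k : V * V * C) :=
  [&& e k.1.1 k.1.2, k.2 \in L k.1.1 & k.2 \in L k.1.2].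

Definition conflict_free (w : sample) := forall u v c,
  e u v -> c \in L u -> c \in L v -> ~~ (w (u, c) && w (v, c)).

Definition conflict_vars (k : V * V * C) : {set V * C} :=
  if conflict_at k then [set (k.1.1, k.2); (k.1.2, k.2)] else set0.

Definition conflict_event (k : V * V * C) (w : sample) :=
  [&& conflict_at k, w (k.1.1, k.2) & w (k.1.2, k.2)].

Lemma depends_conflict_event k :
  depends_on (conflict_vars k) (conflict_event k).
Proof.
rewrite /conflict_vars /conflict_event => w w'.
by case: (conflict_at k) => //= ww'; rewrite !ww' ?inE ?eqxx ?orbT.
Qed.

Lemma card_conflict_vars i :
  (#|[set k | i \in conflict_vars k]| <= 2 * #|colour_nbrs L i.1 i.2|)%N.
Proof.
case: i => a c /=; set N := colour_nbrs L a c.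
rewrite mul2n -addnn.
apply: leq_trans (leq_add (leq_imset_card (fun v => (a, v, c)) (mem N))
                          (leq_imset_card (fun v => (v, a, c)) (mem N))).
apply: leq_trans (leq_card_setU _ _); apply/subset_leq_card/subsetP.
case=> -[u v] d; rewrite inE /conflict_vars /conflict_at /=.
case: ifP => [/and3P[euv du dv]|_]; last by rewrite inE.
rewrite !inE => /orP[] /eqP[ea ec]; apply/orP; [left|right]; apply/imsetP.
  by exists v; rewrite ?ea ?ec // inE ea ec euv dv.
by exists u; rewrite ?ea ?ec // inE ea ec e_sym euv du.
Qed.

Variables (K : finType) (A : K -> pred sample) (S : K -> {set V * C}).
Variables (x : R) (y : K -> R) (M Y : R).
Hypotheses (x_ge0 : 0 <= x) (x_le : x <= 2^-1).
Hypotheses (y_ge0 : forall k, 0 <= y k) (y_le : forall k, y k <= 2^-1).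
Hypothesis depA : forall k, depends_on (S k) (A k).
Hypothesis deg_le : forall v c, c \in L v -> #|colour_nbrs L v c|%:R <= M.
Hypothesis load_le : forall i, \sum_(k | i \in S k) y k <= Y.

(** Each conflict has weight [x], and each further bad event [k] has weight
[y k]. A coordinate [(u, c)] lies in two conflicts for each neighbour of [u]
having [c] in its list, one for each order of the edge, whence the factors [2]
and [4] in front of [x]. *)
Lemma conflict_local_lemma :
  p ^+ 2 <= x * expR (- (2 * (4 * x * M + 2 * Y))) ->
  (forall k, prob p (A k) <= y k * expR (- (2 *
     (2 * x * \sum_(i in S k) #|colour_nbrs L i.1 i.2|%:R
      + \sum_(l | (l != k) && ~~ [disjoint S k & S l]) y l)))) ->
  exists2 w, conflict_free w & forall k, ~~ A k w.
Proof.
move=> conf_small A_small.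
pose S' (j : V * V * C + K) :=
  match j with inl k => conflict_vars k | inr k => S k end.
pose A' (j : V * V * C + K) :=
  match j with inl k => conflict_event k | inr k => A k end.
pose xc k := if conflict_at k then x else 0.
pose x' (j : V * V * C + K) :=
  match j with inl k => xc k | inr k => y k end.
have xc_ge0 k : 0 <= xc k by rewrite /xc; case: ifP.
have sum_conf (T : {set V * C}) : \sum_(k | ~~ [disjoint T & conflict_vars k]) xc k
    <= 2 * x * \sum_(i in T) #|colour_nbrs L i.1 i.2|%:R.
  apply: le_trans (sum_meet_le _ _ xc_ge0) _.
  rewrite mulr_sumr; apply: ler_sum => i _.
  apply: (@le_trans _ _ (\sum_(k | i \in conflict_vars k) x)).
    by apply: ler_sum => k _; rewrite /xc; case: ifP.
  rewrite sumr_const -cardsE -[x *+ _]mulr_natr (mulrC 2) -mulrA ler_wpM2l //.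
  by rewrite -natrM ler_nat card_conflict_vars.
have [w Aw] : exists w, forall j, ~~ A' j w.
  apply: (exp_local_lemma p_ge0 p_le1 (S := S') (x := x')).
  - by move=> [k|k] //=; apply: depends_conflict_event.
  - by move=> [k|k] //=; apply: y_ge0.
  - by move=> [k|k] /=; rewrite ?y_le // /xc; case: ifP; rewrite // invr_ge0.
  move=> [k|k]; rewrite big_sumType /=; last first.
    apply: le_trans (A_small k) _; rewrite ler_wpM2l // ler_expR lerN2.
    rewrite ler_wpM2l // lerD2r.
    by apply: sum_conf.
  rewrite /xc /conflict_event /conflict_vars.
  have [ck|nck] := boolP (conflict_at k); last first.
    by rewrite /= mul0r -(prob0 (V * C)%type p) (eq_prob p (B := pred0)).
  have /and3P[ek k1 k2] := ck.
  rewrite /= prob_both //; last first.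
    by apply: contraTneq ek => -[->]; rewrite e_irr.
  apply: le_trans conf_small _; rewrite ler_wpM2l // ler_expR lerN2.
  have sum2 (T : finType) (a b : T) (f : T -> R) B : 0 <= B ->
      (forall i, i \in [set a; b] -> f i <= B) ->
      \sum_(i in [set a; b]) f i <= 2 * B.
    move=> B0 fB; apply: le_trans (ler_sum _ fB) _.
    rewrite sumr_const cards2 -[B *+ _]mulr_natl ler_wpM2r // ler_nat.
    by case: (a != b).
  have M0 : 0 <= M by apply: le_trans (deg_le k1); apply: ler0n.
  have Y0 : 0 <= Y by apply: le_trans (load_le (k.1.1, k.2)); apply: sumr_ge0.
  rewrite ler_wpM2l // lerD //.
    apply: le_trans (_ : _ <= 2 * x * (2 * M)) _; last by lra.
    apply: le_trans (le_trans _ (sum_conf [set (k.1.1, k.2); (k.1.2, k.2)])) _.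
      rewrite big_mkcond [leRHS]big_mkcond; apply: ler_sum => l _ /=.
      rewrite /conflict_vars; case: (l != k) => //=.
      by case: ifP => // _; apply: xc_ge0.
    rewrite ler_wpM2l ?mulr_ge0 //; apply: sum2 => // i.
    by rewrite !inE => /orP[]/eqP->; apply: deg_le.
  apply: le_trans (sum_meet_le _ _ y_ge0) _.
  by apply: sum2 => // i _; apply: load_le.
exists w => [u v c euv cu cv|k]; last exact: (Aw (inr k)).
by have := Aw (inl (u, v, c)); rewrite /= /conflict_event /conflict_at /= euv cu cv.
Qed.

End ConflictLocalLemma.

End ColourDegrees.

(** * Colouring by independent trials *)

Section Trials.

Variables (V C : finType) (e : rel V).
Hypotheses (e_sym : symmetric e) (e_irr : irreflexive e).

Implicit Types (L : V -> {set C}) (w : {ffun V * C -> bool}).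

(** Vertices that are already coloured are represented by an empty list: they
then contribute to no colour degree and impose no constraint. *)
Definition list_colourable L := exists phi : V -> C,
  (forall v, L v != set0 -> phi v \in L v) /\
  (forall u v, e u v -> L u != set0 -> L v != set0 -> phi u != phi v).

Definition vertex_block L u : {set V * C} := [set i | i.1 == u & i.2 \in L u].

Definition colour_block L v c : {set V * C} :=
  [set i | i.1 \in colour_nbrs e L v c & i.2 == c].

Definition untried L w u := none_in (vertex_block L u) w.

Definition kept L w v := [set c in L v | none_in (colour_block L v c) w].

Lemma card_vertex_block L u : #|vertex_block L u| = #|L u|.
Proof.
have inj : injective (fun c : C => (u, c)) by move=> ? ? [].
rewrite -(card_imset _ inj).
apply: eq_card => -[v c]; rewrite inE /=; apply/andP/imsetP.
  by case=> /eqP-> cu; exists c.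
by case=> d du [-> ->]; rewrite eqxx.
Qed.

Lemma card_colour_block L v c : #|colour_block L v c| = #|colour_nbrs e L v c|.
Proof.
have inj : injective (fun u : V => (u, c)) by move=> ? ? [].
rewrite -(card_imset _ inj).
apply: eq_card => -[u d]; rewrite inE /=; apply/andP/imsetP.
  by case=> uv /eqP->; exists u.
by case=> x xv [-> ->]; rewrite eqxx.
Qed.

Lemma triedP L w u :
  reflect (exists2 c, c \in L u & w (u, c)) (~~ untried L w u).
Proof.
apply: (iffP forallPn) => [[[v c]]|[c cu wc]]; last first.
  by exists (u, c); rewrite inE /= eqxx cu wc.
by rewrite negb_imply negbK inE /= => /andP[/andP[/eqP-> cu] wc]; exists c.
Qed.

(** A vertex that tried colours takes one of them, and the others follow the
colouring of the remaining lists; these avoid every colour tried by a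
neighbour, whether or not the neighbour takes it. *)
Lemma colour_after_trials L L' w : conflict_free e L w ->
  (forall v, L' v \subset kept L w v) ->
  (forall v, L v != set0 -> untried L w v -> L' v != set0) ->
  list_colourable L' -> list_colourable L.
Proof.
move=> cfw L'k L'n [phi [phiL phie]].
pose psi v := odflt (phi v) [pick c in L v | w (v, c)].
have psiP v : L v != set0 ->
    (psi v \in L v /\ w (v, psi v)) \/
    [/\ L' v != set0, psi v = phi v & psi v \in kept L w v].
  move=> Lv; rewrite /psi; case: pickP => [c /andP[]|none] /=; first by left.
  have unt : untried L w v.
    apply: contraT => /triedP[c cv wc]; have := none c.
    by rewrite cv wc.
  have L'v := L'n v Lv unt.
  by right; split=> //; apply: (subsetP (L'k v)); apply: phiL.
have keptN u v c : e u v -> c \in kept L w v -> c \in L u -> ~~ w (u, c).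
  move=> euv; rewrite inE => /andP[cv /'forall_implyP ncw] cu.
  by apply: ncw; rewrite !inE /= e_sym euv cu eqxx.
exists psi; split=> [v Lv|u v euv Lu Lv].
  by case: (psiP v Lv) => [[]|[_ _]] //; rewrite inE => /andP[].
apply/eqP => eq_psi.
case: (psiP u Lu) => [[pu wu]|[L'u pu ku]];
  case: (psiP v Lv) => [[pv wv]|[L'v pv kv]].
- by have := cfw u v (psi u) euv pu; rewrite {1 3}eq_psi => /(_ pv); rewrite wu wv.
- by move: (keptN _ _ _ euv kv); rewrite -eq_psi => /(_ pu); rewrite wu.
- rewrite e_sym in euv.
  by move: (keptN _ _ _ euv ku); rewrite eq_psi => /(_ pv); rewrite wv.
- by move: (phie u v euv L'u L'v); rewrite -pu -pv eq_psi eqxx.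
Qed.

Lemma colour_nbrs_after_trials L L' w v c :
  (forall u, L' u \subset kept L w u) ->
  (forall u, ~~ untried L w u -> L' u = set0) ->
  colour_nbrs e L' v c \subset [set u in colour_nbrs e L v c | untried L w u].
Proof.
move=> L'k L'0; apply/subsetP => u; rewrite !inE => /andP[-> cu] /=.
have := subsetP (L'k u) c cu; rewrite inE => /andP[-> _] /=.
by apply: contraLR cu => /L'0 ->; rewrite inE.
Qed.

Section Finish.

Variables (R : realType) (l : nat) (D M : R) (L : V -> {set C}).
Hypothesis card_L : forall v, L v != set0 -> #|L v| = l.
Hypothesis sum_deg : forall v,
  \sum_(c in L v) #|colour_nbrs e L v c|%:R <= D * l%:R.
Hypothesis deg_le : forall v c, c \in L v -> #|colour_nbrs e L v c|%:R <= M.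

Lemma sum_vertex_block v (f : V * C -> R) :
  \sum_(i in vertex_block L v) f i = \sum_(c in L v) f (v, c).
Proof.
rewrite (eq_bigl (fun i => (i.1 == v) && (i.2 \in L v))); last first.
  by move=> i; rewrite inE.
rewrite (eq_bigr (fun i => f (i.1, i.2))); last by case.
by rewrite -(pair_big (pred1 v) [in L v] (fun u c => f (u, c))) big_pred1_eq.
Qed.

(** With [p * l = 7] a vertex tries nothing with probability at most [1 / 8],
below the weight [1 / 4] given to this event. The conflicts, of weight
[16 * p ^+ 2], are rare since the degrees are small compared to [l]; thus in
some sample every vertex tries a colour and no conflict occurs. *)
Lemma list_colourable_of_long_lists (c0 : C) : (40 <= l)%N ->
  64 * 98 * D <= l%:R -> 64 * 98 * M <= l%:R ^+ 2 -> list_colourable L.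
Proof.
move=> l40 Dl Ml.
have l0 : 0 < l%:R :> R by rewrite ltr0n (leq_trans _ l40).
pose p : R := 7 / l%:R.
have pl : p * l%:R = 7 by rewrite /p divfK // gt_eqF.
have p0 : 0 <= p by rewrite divr_ge0 // ltW.
have l40' : 40 <= l%:R :> R by rewrite (ler_nat _ 40).
have p1 : p <= 1 by rewrite ler_pdivrMr // mul1r (le_trans _ l40') //; lra.
have p2 : 16 * p ^+ 2 <= 2^-1.
  rewrite /p expr_div_n mulrA ler_pdivrMr ?exprn_gt0 //; nra.
have pM : 128 * (p ^+ 2 * M) <= 1.
  rewrite /p expr_div_n mulrAC mulrA ler_pdivrMr ?exprn_gt0 //; lra.
have pD : 64 * (p ^+ 2 * (D * l%:R)) <= 2^-1.
  have -> : p ^+ 2 * (D * l%:R) = 7 * (p * D) by rewrite -pl; ring.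
  have -> : p * D = 7 * D / l%:R by rewrite /p mulrAC.
  rewrite mulrCA mulrA mulrA ler_pdivrMr //; lra.
have p2_ge0 : 0 <= 16 * p ^+ 2 by rewrite mulr_ge0 ?sqr_ge0.
pose A v w := (L v != set0) && untried L w v.
have load i : \sum_(v | i \in vertex_block L v) 4^-1 <= 4^-1 :> R.
  apply: (@le_trans _ _ (\sum_(v | v == i.1) 4^-1)); last by rewrite big_pred1_eq.
  rewrite big_mkcond [leRHS]big_mkcond; apply: ler_sum => v _.
  rewrite inE eq_sym; case: eqP => //= _; case: ifP => // _.
  by rewrite invr_ge0.
have [||||v|w cfw Aw] := conflict_local_lemma e_sym e_irr p0 p1
  (A := A) (S := vertex_block L) (x := 16 * p ^+ 2) (y := fun=> 4^-1)
  p2_ge0 p2 _ _ _ deg_le load.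
- by move=> _; rewrite invr_ge0.
- by move=> _; lra.
- by move=> v w w' ww'; rewrite /A /untried (depends_none_in ww').
- have h : 16^-1 <= expR (- 2) :> R.
    rewrite expRN lef_pV2 ?posrE ?expR_gt0 //.
    rewrite (_ : 2 = 1 + 1) ?expRD; last by lra.
    have := expR1_le4 R; have := expR_ge0 (1 : R); nra.
  set E := expR _; have hE : 16^-1 <= E.
    by apply: le_trans h _; rewrite ler_expR; lra.
  rewrite (_ : 16 * p ^+ 2 * E = p ^+ 2 * (16 * E)) ?ler_peMr ?sqr_ge0 //; lra.
- rewrite [X in _ + X]big1 ?addr0; last first.
    move=> u /andP[uv /pred0Pn[[x c]]]; rewrite /= !inE /=.
    by move=> /andP[/andP[/eqP-> _]]; rewrite eq_sym (negbTE uv).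
  have [Lv|Lv] := boolP (L v != set0); last first.
    rewrite (eq_prob p (B := pred0)); last by move=> w; rewrite /A (negbTE Lv).
    by rewrite prob0 mulr_ge0 ?expR_ge0 ?invr_ge0.
  rewrite (eq_prob p (B := none_in (vertex_block L v)));
    last by move=> w; rewrite /A Lv.
  rewrite prob_none_in card_vertex_block card_L //.
  apply: le_trans (exprn_1subr_le _ p0 p1) _.
  rewrite pl (_ : (1 + 7)^-1 = 4^-1 * 2^-1 :> R); last first.
    by rewrite -invfM; congr _^-1; ring.
  rewrite ler_wpM2l ?invr_ge0 //; apply: le_trans (expRN_half R) _.
  rewrite ler_expR lerN2 sum_vertex_block /=.
  have := sum_deg v; have := sqr_ge0 p; nra.
pose phi v := odflt c0 [pick c in L v | w (v, c)].
have phiP v : L v != set0 -> phi v \in L v /\ w (v, phi v).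
  move=> Lv; have := Aw v; rewrite /A Lv /= => /triedP[c cv wc].
  by rewrite /phi; case: pickP => [d /andP[]//|/(_ c)]; rewrite cv wc.
exists phi; split=> [v /phiP[]//|u v euv /phiP[pu wu] /phiP[pv wv]].
apply/eqP => eq_phi; rewrite -eq_phi in pv wv.
by have := cfw u v _ euv pu pv; rewrite wu wv.
Qed.

End Finish.
End Trials.

(** * One random round *)

Section RandomStep.

Variables (V C : finType) (e : rel V).
Hypotheses (e_sym : symmetric e) (e_irr : irreflexive e).
Variables (R : realType) (p : R) (l : nat) (D M : R) (L : V -> {set C}).
Hypotheses (p_ge0 : 0 <= p) (p_le1 : p <= 1) (D_ge0 : 0 <= D) (D_le : D <= M).
Hypotheses (l_le : l%:R <= M) (M_gt0 : 0 < M).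
Hypothesis card_L : forall v, L v != set0 -> #|L v| = l.

Local Notation deg v c := #|colour_nbrs e L v c|.
Local Notation sample := {ffun V * C -> bool}.

Hypothesis sum_deg : forall v, \sum_(c in L v) (deg v c)%:R <= D * l%:R.
Hypothesis deg_le : forall v c, c \in L v -> (deg v c)%:R <= M.

Implicit Types (w : sample) (F : V * C -> R).

Lemma mem_card_L v c : c \in L v -> #|L v| = l.
Proof. by move=> cv; apply: card_L; apply/set0Pn; exists c. Qed.

Variables (lam s g : R).
Hypotheses (lam_ge0 : 0 <= lam) (lam_le : lam <= 2^-1) (s_ge0 : 0 <= s).
(** One condition serves the three tails below. The excess has weights up to
[M] and tolerance [s * l]; dividing by [M] leaves the tolerance [s * l / M],
which is at most the tolerance [s] of the two counts with unit weights. *)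
Hypothesis tail_small :
  2 * lam ^+ 2 * (p * l%:R * M) - lam * s * l%:R / M <= - (2 * g).

Lemma scaled_deviation_le : lam * s * l%:R / M <= lam * s.
Proof. by rewrite ler_pdivrMr // ler_wpM2l // mulr_ge0. Qed.

Lemma expected_loss_le (v : V) :
  \sum_(c in L v) (1 - (1 - p) ^+ deg v c) <= p * D * l%:R.
Proof.
rewrite -mulrA; apply: le_trans (ler_wpM2l p_ge0 (sum_deg v)).
rewrite mulr_sumr; apply: ler_sum => c _; exact: exprn_1subr_ge.
Qed.

Lemma degree_tail v c : c \in L v ->
  prob p (fun w => (1 - p) ^+ l * (deg v c)%:R + s <=
            #|[set u in colour_nbrs e L v c | untried L w u]|%:R)
  <= expR (- (2 * g)).
Proof.
move=> cv; set X := colour_nbrs e L v c.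
have disX : {in X &, forall u u', u != u' ->
    [disjoint vertex_block L u & vertex_block L u']}.
  move=> u u' _ _ uu'; apply/pred0P => i /=; rewrite !inE.
  by case: eqP => //= ->; rewrite (negbTE uu') andbF.
have lX u : u \in X -> #|vertex_block L u| = l.
  by rewrite inE card_vertex_block => /andP[_ /mem_card_L].
have lamX u : u \in X -> `|lam * 1| <= 2^-1 by rewrite mulr1 ger0_norm.
have E1 : \sum_(u in X) 1 * (1 - p) ^+ #|vertex_block L u|
    = (1 - p) ^+ l * (deg v c)%:R.
  rewrite mulr_natr -sumr_const; apply: eq_bigr => u /lX ->; exact: mul1r.
have E2 : \sum_(u in X) (1 - (1 - p) ^+ #|vertex_block L u|) * 1 ^+ 2
    = (1 - (1 - p) ^+ l) * (deg v c)%:R.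
  rewrite mulr_natr -sumr_const; apply: eq_bigr => u /lX ->.
  by rewrite expr1n mulr1.
have := block_tail p_ge0 p_le1 disX (a := fun=> 1) s lam_ge0 lamX.
rewrite E1 E2 => tail; apply: le_trans (le_trans _ tail) _; last first.
  rewrite ler_expR; apply: le_trans tail_small; rewrite lerB ?scaled_deviation_le //.
  rewrite ler_wpM2l ?mulr_ge0 ?sqr_ge0 // ler_pM ?deg_le //.
    by rewrite subr_ge0 exprn_ile1 // ?subr_ge0 // gerBl.
  exact: exprn_1subr_ge.
apply: le_prob => // w; rewrite (eq_bigr (fun u => (untried L w u)%:R));
  last by move=> u _; rewrite mul1r.
rewrite -natr_sum.
suff -> : (\sum_(u in X) untried L w u)%N
    = #|[set u in X | untried L w u]| by [].
rewrite -sum1_card [LHS]big_mkcond [RHS]big_mkcond; apply: eq_bigr => u _.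
by rewrite inE; case: (u \in X); case: untried.
Qed.

Lemma colour_block_disjoint v : {in L v &, forall c d, c != d ->
  [disjoint colour_block e L v c & colour_block e L v d]}.
Proof.
move=> c d _ _ cd; apply/pred0P => i /=; rewrite !inE.
by case: eqP => //= [->|]; rewrite ?andbF // (negbTE cd) !andbF.
Qed.

Lemma sum_kept v w (f : C -> R) :
  \sum_(c in kept e L w v) f c
    = \sum_(c in L v) f c * (none_in (colour_block e L v c) w)%:R.
Proof.
rewrite (eq_bigl (fun c => (c \in L v) && none_in (colour_block e L v c) w));
  last by move=> c; rewrite inE.
rewrite big_mkcondr; apply: eq_bigr => c _.
by case: none_in; rewrite ?mulr1 ?mulr0.
Qed.

Lemma kept_tail v : L v != set0 ->
  prob p (fun w => #|kept e L w v|%:R <= l%:R - p * D * l%:R - s)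
    <= expR (- (2 * g)).
Proof.
move=> Lv.
have lamX c : c \in L v -> `|lam * -1| <= 2^-1.
  by rewrite mulrN1 normrN ger0_norm.
have := block_tail p_ge0 p_le1 (@colour_block_disjoint v) (a := fun=> -1)
  s lam_ge0 lamX.
have -> : \sum_(c in L v) -1 * (1 - p) ^+ #|colour_block e L v c|
    = - \sum_(c in L v) (1 - p) ^+ deg v c.
  by rewrite -sumrN; apply: eq_bigr => c _; rewrite card_colour_block mulN1r.
have -> : \sum_(c in L v) (1 - (1 - p) ^+ #|colour_block e L v c|) * (- 1) ^+ 2
    = \sum_(c in L v) (1 - (1 - p) ^+ deg v c).
  by apply: eq_bigr => c _; rewrite card_colour_block sqrrN expr1n mulr1.
move=> tail; apply: le_trans (le_trans _ tail) _; last first.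
  rewrite ler_expR; apply: le_trans tail_small; rewrite lerB ?scaled_deviation_le //.
  rewrite ler_wpM2l ?mulr_ge0 ?sqr_ge0 //.
  apply: le_trans (expected_loss_le v) _; rewrite mulrAC -!mulrA ler_wpM2l //.
  by rewrite ler_wpM2l.
apply: le_prob => // w h.
have -> : \sum_(c in L v) -1 * (none_in (colour_block e L v c) w)%:R
    = - #|kept e L w v|%:R :> R.
  by rewrite -sum_kept sumrN sumr_const.
have := expected_loss_le v; rewrite sumrB sumr_const (card_L Lv); lra.
Qed.

(** Chebyshev's sum inequality: the survival probability [(1 - p) ^+ d] is
nonincreasing in the degree [d], so the survivors are biased towards small
degrees. *)
Lemma mean_excess_le0 v :
  \sum_(c in L v) ((deg v c)%:R - D) * (1 - p) ^+ deg v c <= 0.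
Proof.
(* Comparing with the survival probability at the integer part of [D] makes
   every term nonpositive after subtraction. *)
pose m := Num.truncn D.
have hp0 : 0 <= 1 - p by rewrite subr_ge0.
have hp1 : 1 - p <= 1 by rewrite gerBl.
apply: (@le_trans _ _ ((\sum_(c in L v) ((deg v c)%:R - D)) * (1 - p) ^+ m)).
  rewrite mulr_suml; apply: ler_sum => c _; set d := deg v c.
  have [Dd|dD] := leP D d%:R.
    rewrite ler_wpM2l ?subr_ge0 // ler_wiXn2l //.
    by rewrite -(ler_nat R) (le_trans _ Dd) // truncn_le.
  rewrite ler_wnM2l ?subr_le0 ?(ltW dD) // ler_wiXn2l //.
  by rewrite truncn_ge_nat // ltW.
rewrite mulr_le0_ge0 ?exprn_ge0 // sumrB sumr_const subr_le0.
have [L0|/card_L ->] := eqVneq (L v) set0.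
  by rewrite L0 big_set0 cards0.
by rewrite -mulr_natr.
Qed.

Lemma excess_tail v : L v != set0 ->
  prob p (fun w => s * l%:R <= \sum_(c in kept e L w v) ((deg v c)%:R - D))
    <= expR (- (2 * g)).
Proof.
move=> Lv.
have absX c : c \in L v -> `|(deg v c)%:R - D| <= M.
  move=> cv; have := deg_le cv; have := ler0n R (deg v c).
  have DM := D_le; have D0 := D_ge0.
  by rewrite ler_norml => h1 h2; apply/andP; split; lra.
have lamM0 : 0 <= lam / M by rewrite divr_ge0 // ltW.
have lamX c : c \in L v -> `|lam / M * ((deg v c)%:R - D)| <= 2^-1.
  move=> cv; rewrite normrM (ger0_norm lamM0).
  apply: le_trans (_ : _ <= lam / M * M) _; first by rewrite ler_wpM2l ?absX.
  by rewrite divfK // gt_eqF.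
have := block_tail p_ge0 p_le1 (@colour_block_disjoint v)
  (a := fun c => (deg v c)%:R - D) (s * l%:R) lamM0 lamX.
have -> : \sum_(c in L v) ((deg v c)%:R - D) * (1 - p) ^+ #|colour_block e L v c|
    = \sum_(c in L v) ((deg v c)%:R - D) * (1 - p) ^+ deg v c.
  by apply: eq_bigr => c _; rewrite card_colour_block.
have -> : \sum_(c in L v) (1 - (1 - p) ^+ #|colour_block e L v c|)
      * ((deg v c)%:R - D) ^+ 2
    = \sum_(c in L v) (1 - (1 - p) ^+ deg v c) * ((deg v c)%:R - D) ^+ 2.
  by apply: eq_bigr => c _; rewrite card_colour_block.
move=> tail; apply: le_trans (le_trans _ tail) _; last first.
  rewrite ler_expR; apply: le_trans tail_small; rewrite lerB //; last first.
    by rewrite le_eqVlt; apply/orP; left; apply/eqP; ring.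
  apply: (@le_trans _ _ (2 * (lam / M) ^+ 2 * (p * l%:R * M * M ^+ 2))).
    have h0 : 0 <= 2 * (lam / M) ^+ 2 by rewrite mulr_ge0 // sqr_ge0.
    rewrite ler_wpM2l //.
    apply: (@le_trans _ _ (\sum_(c in L v) (1 - (1 - p) ^+ deg v c) * M ^+ 2)).
      apply: ler_sum => c cv; rewrite ler_wpM2l //.
        by rewrite subr_ge0 exprn_ile1 // ?subr_ge0 // gerBl.
      by rewrite -real_normK ?num_real // lerXn2r ?nnegrE ?absX // ltW.
    rewrite -mulr_suml ler_wpM2r ?sqr_ge0 //.
    apply: le_trans (expected_loss_le v) _; rewrite mulrAC -!mulrA ler_wpM2l //.
    by rewrite ler_wpM2l.
  rewrite expr_div_n le_eqVlt; apply/orP; left; apply/eqP.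
  by field; rewrite gt_eqF.
apply: le_prob => // w h.
by rewrite -sum_kept; have := mean_excess_le0 v; lra.
Qed.

Definition list_scope v : {set V * C} :=
  [set i | i.1 \in colour_nbrs e L v i.2 & i.2 \in L v].

Definition degree_scope v c : {set V * C} :=
  [set i | (c \in L v) && (i.1 \in colour_nbrs e L v c) & i.2 \in L i.1].

Lemma sum_list_scope v F :
  \sum_(i in list_scope v) F i
    = \sum_(c in L v) \sum_(u in colour_nbrs e L v c) F (u, c).
Proof.
rewrite (exchange_big_dep predT) //= pair_big_dep /=.
apply: eq_big => [i|[u c] _ //]; rewrite !inE /=.
by case: (i.2 \in L v); rewrite ?andbT ?andbF.
Qed.

Lemma sum_degree_scope v c F : c \in L v ->
  \sum_(i in degree_scope v c) F i
    = \sum_(u in colour_nbrs e L v c) \sum_(d in L u) F (u, d).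
Proof.
move=> cv; rewrite pair_big_dep /=.
by apply: eq_big => [i|[u d] _ //]; rewrite !inE cv.
Qed.

Lemma sum_list_scope_le v F (b : R) :
  (forall u c, c \in L u -> F (u, c) <= b) -> 0 <= b ->
  \sum_(i in list_scope v) F i <= M * (b * l%:R).
Proof.
move=> Fb b0; rewrite sum_list_scope.
apply: (@le_trans _ _ (\sum_(c in L v) (deg v c)%:R * b)).
  apply: ler_sum => c cv; rewrite mulr_natl -sumr_const; apply: ler_sum => u.
  by rewrite inE => /andP[_]; apply: Fb.
rewrite -mulr_suml mulrCA mulrC ler_wpM2l //.
by apply: le_trans (sum_deg v) _; rewrite ler_wpM2r.
Qed.

Lemma sum_degree_scope_le v c F (b : R) :
  (forall u, \sum_(d in L u) F (u, d) <= b) -> 0 <= b ->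
  \sum_(i in degree_scope v c) F i <= M * b.
Proof.
move=> Fb b0; have [cv|ncv] := boolP (c \in L v); last first.
  rewrite big_pred0; first by rewrite mulr_ge0 // ltW.
  by move=> i; rewrite inE (negbTE ncv).
rewrite sum_degree_scope //; apply: le_trans (ler_sum _ (fun u _ => Fb u)) _.
by rewrite sumr_const -[b *+ _]mulr_natl ler_wpM2r // deg_le.
Qed.

Definition scope (k : V + C * V) :=
  match k with inl v => list_scope v | inr (c, v) => degree_scope v c end.

(** One event for the list of each vertex and one for each vertex and colour.
With a single event for all the degrees at a vertex, the scope would contain
the trials of all its neighbours, and the conflicts meeting it would outweigh
its probability. *)
Definition bad_event (k : V + C * V) (w : sample) : bool :=
  match k with
  | inl v => (L v != set0) &&
      ((#|kept e L w v|%:R <= l%:R - p * D * l%:R - s) ||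
       (s * l%:R <= \sum_(c in kept e L w v) ((deg v c)%:R - D)))
  | inr (c, v) => (c \in L v) && ((1 - p) ^+ l * (deg v c)%:R + s <=
            #|[set u in colour_nbrs e L v c | untried L w u]|%:R)
  end.

Lemma depends_bad_event k : depends_on (scope k) (bad_event k).
Proof.
case: k => [v|[c v]] w w' ww' /=.
  rewrite (_ : kept e L w v = kept e L w' v) //.
  apply/setP => c; rewrite !inE; have [cv|//] := boolP (c \in L v).
  apply: depends_none_in => i; rewrite inE => /andP[iv /eqP ic].
  by apply: ww'; rewrite inE ic cv iv.
have [cv|//] := boolP (c \in L v).
rewrite (_ : [set u in colour_nbrs e L v c | untried L w u]
           = [set u in colour_nbrs e L v c | untried L w' u]) //.
apply/setP => u; rewrite !inE; have [eu|//] := boolP (e v u).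
have [cu|//] := boolP (c \in L u); apply: depends_none_in => i.
rewrite inE => /andP[/eqP iu iL].
by apply: ww'; rewrite !inE iu cv eu cu iL.
Qed.

Lemma prob_bad_event k : prob p (bad_event k) <= 2 * expR (- (2 * g)).
Proof.
have E0 := expR_ge0 (- (2 * g)).
have vacuous k' : bad_event k' =1 pred0 ->
    prob p (bad_event k') <= 2 * expR (- (2 * g)).
  by move=> /(eq_prob p) ->; rewrite prob0 mulr_ge0.
case: k => [v|[c v]].
  have [Lv|Lv] := boolP (L v != set0); last first.
    by apply: vacuous => w /=; rewrite (negbTE Lv).
  rewrite (_ : 2 * _ = expR (- (2 * g)) + expR (- (2 * g))); last by ring.
  apply: le_trans (lerD (kept_tail Lv) (excess_tail Lv)).
  apply: le_trans (prob_setU p_ge0 p_le1 _ _).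
  by apply: le_prob => // w /andP[].
have [cv|ncv] := boolP (c \in L v); last first.
  by apply: vacuous => w /=; rewrite (negbTE ncv).
apply: (@le_trans _ _ (expR (- (2 * g)))); last by lra.
by apply: le_trans (degree_tail cv); apply: le_prob => // w /andP[].
Qed.

(** The trial of [d] by [u] is relevant to the lists of the neighbours of [u]
that have the colour [d], and to the degrees of any colour shared with a
neighbour; the latter are counted by the sum of the colour degrees of [u]. *)
Lemma scope_load_le i (y : R) : 0 <= y ->
  \sum_(k | i \in scope k) y <= M * (l%:R + 1) * y.
Proof.
move=> y0; case: i => u d; rewrite big_sumType /= mulrDr mulr1 mulrDl addrC.
apply: lerD.
  apply: (@le_trans _ _ (\sum_(k : C * V | (k.1 \in L u) &&
                            (k.2 \in colour_nbrs e L u k.1)) y)).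
    rewrite big_mkcond [leRHS]big_mkcond; apply: ler_sum => -[c v] _ /=.
    case: ifP; last by case: ifP.
    by rewrite !inE /= e_sym => /andP[/andP[-> /andP[-> ->]]].
  rewrite -(pair_big_dep [in L u] (fun c v => v \in colour_nbrs e L u c)
    (fun _ _ => y)) /=.
  rewrite (eq_bigr (fun c => (deg u c)%:R * y)); last first.
    by move=> c _; rewrite sumr_const mulr_natl.
  rewrite -mulr_suml ler_wpM2r //; apply: le_trans (sum_deg u) _.
  by rewrite ler_wpM2r.
have [du|ndu] := boolP (d \in L u); last first.
  rewrite big_pred0; first by rewrite mulr_ge0 // ltW.
  by move=> v; rewrite !inE (negbTE ndu) andbF.
apply: (@le_trans _ _ (\sum_(v in colour_nbrs e L u d) y)); last first.
  by rewrite sumr_const -[y *+ _]mulr_natl ler_wpM2r // deg_le.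
rewrite big_mkcond [leRHS]big_mkcond; apply: ler_sum => v _ /=.
case: ifP; last by case: ifP.
by rewrite !inE /= e_sym => /andP[/andP[-> _] ->].
Qed.

Local Notation Y := (M * (l%:R + 1) * expR (- g)).

(** The conflicts have probability [p ^+ 2] and weight [2 * p ^+ 2], the
deviations have probability at most [2 * expR (- (2 * g))] and weight
[expR (- g)]. The last hypothesis says that the remaining factor [expR (- g)]
pays for the factor [2] and for the weights of the conflicts and of the other
deviations met by a deviation event. *)
Lemma random_step :
  2 * p ^+ 2 <= 2^-1 -> expR (- g) <= 2^-1 ->
  2 * (8 * p ^+ 2 * M + 2 * Y) <= 2^-1 ->
  1 + 8 * p ^+ 2 * (M * D * l%:R) + 2 * (M * l%:R * Y) <= g ->
  exists2 w, conflict_free e L w &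
    forall v, L v != set0 ->
     [/\ l%:R - p * D * l%:R - s <= #|kept e L w v|%:R,
         \sum_(c in kept e L w v) ((deg v c)%:R - D) <= s * l%:R
       & forall c, c \in L v ->
         #|[set u in colour_nbrs e L v c | untried L w u]|%:R
           <= (1 - p) ^+ l * (deg v c)%:R + s].
Proof.
move=> p2 g2 conf_small tail_beats.
have Eg := expR_ge0 (- g).
have M0 := ltW M_gt0.
have Y0 : 0 <= Y by rewrite !mulr_ge0 // addr_ge0.
have x0 : 0 <= 2 * p ^+ 2 by rewrite mulr_ge0 // sqr_ge0.
have load i := scope_load_le i Eg.
have sum1 u : \sum_(d in L u) 1 <= l%:R :> R.
  rewrite sumr_const; have [->|/card_L ->//] := eqVneq (L u) set0.
  by rewrite cards0.
have [|k|w cfw Aw] := conflict_local_lemma e_sym e_irr p_ge0 p_le1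
  x0 p2 (fun=> Eg) (fun=> g2) depends_bad_event deg_le load.
- set E := expR _; have hE : 2^-1 <= E.
    apply: le_trans (expRN_half R) _.
    by rewrite ler_expR lerN2; move: conf_small; lra.
  rewrite (_ : 2 * p ^+ 2 * E = p ^+ 2 * (2 * E)) ?ler_peMr ?sqr_ge0 //; lra.
- apply: le_trans (prob_bad_event k) _.
  rewrite (_ : - (2 * g) = - g + - g); last by ring.
  rewrite expRD mulrCA ler_wpM2l //.
  apply: (@le_trans _ _ (expR (1 - g))).
    by rewrite expRD ler_wpM2r //; apply: le_trans (expR_ge1Dx _); lra.
  rewrite ler_expR.
  have scopeY : \sum_(i in scope k) Y <= M * (Y * l%:R).
    case: k => [v|[c v]] /=; first exact: sum_list_scope_le.
    apply: sum_degree_scope_le; last by rewrite mulr_ge0.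
    move=> u; rewrite sumr_const -[_ *+ _]mulr_natr ler_wpM2l //.
    by move: (sum1 u); rewrite sumr_const.
  have scopeD : \sum_(i in scope k) (deg i.1 i.2)%:R <= M * (D * l%:R).
    case: k {scopeY} => [v|[c v]] /=; last first.
      by apply: sum_degree_scope_le => [u|]; rewrite ?sum_deg // mulr_ge0.
    rewrite sum_list_scope /=.
    apply: (@le_trans _ _ (\sum_(c in L v) (deg v c)%:R * M)).
      apply: ler_sum => c cv; rewrite mulr_natl -sumr_const; apply: ler_sum => u.
      by rewrite inE => /andP[_]; apply: deg_le.
    by rewrite -mulr_suml mulrC ler_wpM2l.
  have meet : \sum_(k' | (k' != k) && ~~ [disjoint scope k & scope k']) expR (- g)
      <= M * (Y * l%:R).
    apply: le_trans scopeY; apply: le_trans (le_trans (_ : _ <= _)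
      (sum_meet_le (scope k) scope (fun=> Eg))) _; last first.
      by apply: ler_sum.
    rewrite big_mkcond [leRHS]big_mkcond; apply: ler_sum => k' _ /=.
    by case: (k' != k) => //=; case: ifP.
  have p2D := ler_wpM2l x0 scopeD.
  move: p2D meet tail_beats.
  set SD := \sum_(i in scope k) _; set SY := \sum_(k' | _) _; set E := expR _.
  by move=> h1 h2 h3; nra.
exists w => // v Lv; split=> [||c cv].
- by have := Aw (inl v); rewrite /= Lv /= negb_or -!ltNge => /andP[/ltW].
- by have := Aw (inl v); rewrite /= Lv /= negb_or -!ltNge => /andP[_ /ltW].
- by have := Aw (inr (c, v)); rewrite /= cv /= -ltNge => /ltW.
Qed.

End RandomStep.

(** * From a good sample to the next lists *)

Section Rounds.

Variables (V C : finType) (e : rel V).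
Hypotheses (e_sym : symmetric e) (e_irr : irreflexive e).
Variable R : realType.

Definition balanced (l : nat) (D M : R) (L : V -> {set C}) : Prop :=
  [/\ forall v, L v != set0 -> #|L v| = l,
      forall v, \sum_(c in L v) #|colour_nbrs e L v c|%:R <= D * l%:R
    & forall v c, c \in L v -> #|colour_nbrs e L v c|%:R <= M].

(** The lists that remain are cut to the common length [l'] so that survival
probabilities are again functions of the degree. The cut minimises the degrees
towards the untried vertices, which bound the new colour degrees whatever the
cuts made at the neighbours. In the new average, the excess of the survivors and
the deviations of their degrees add up to at most [3 * s], since at least half
of each list survives. *)
Lemma colouring_round (l l' : nat) (p D D' M lam s g : R) (L : V -> {set C}) :
  balanced l D M L ->
  0 <= p -> p <= 1 -> 0 <= D -> D <= M -> l%:R <= M -> 0 < M ->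
  0 <= lam -> lam <= 2^-1 -> 0 <= s ->
  2 * lam ^+ 2 * (p * l%:R * M) - lam * s * l%:R / M <= - (2 * g) ->
  2 * p ^+ 2 <= 2^-1 -> expR (- g) <= 2^-1 ->
  2 * (8 * p ^+ 2 * M + 2 * (M * (l%:R + 1) * expR (- g))) <= 2^-1 ->
  1 + 8 * p ^+ 2 * (M * D * l%:R)
    + 2 * (M * l%:R * (M * (l%:R + 1) * expR (- g))) <= g ->
  (0 < l')%N -> (l <= l'.*2)%N ->
  (forall n : nat, l%:R - p * D * l%:R - s <= n%:R -> (l' <= n)%N) ->
  (1 - p) ^+ l * D + 3 * s <= D' ->
  exists2 L', balanced l' D' M L' &
    list_colourable e L' -> list_colourable e L.
Proof.
move=> [card_L sum_deg deg_le] p0 p1 D0 DM lM M0 lam0 lam2 s0 tail p2 g2 conf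
  beats l'0 ll' l'le D'le.
have [w cfw good] := random_step e_sym e_irr p0 p1 D0 DM lM M0 card_L sum_deg
  deg_le lam0 lam2 s0 tail p2 g2 conf beats.
pose f v c : R := #|[set u in colour_nbrs e L v c | untried L w u]|%:R.
have f_le v c : f v c <= #|colour_nbrs e L v c|%:R.
  by rewrite ler_nat subset_leq_card //; apply/subsetP => u; rewrite inE => /andP[].
have [hp0 hp1] : 0 <= 1 - p /\ 1 - p <= 1 by rewrite subr_ge0 gerBl.
have q0 : 0 <= (1 - p) ^+ l by rewrite exprn_ge0.
have q1 : (1 - p) ^+ l <= 1 by rewrite exprn_ile1.
have choose v : exists B : {set C}, [/\ B \subset kept e L w v,
     (B != set0) = (L v != set0) && untried L w v, B != set0 -> #|B| = l'
     & \sum_(c in B) f v c <= D' * l'%:R].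
  have [/andP[Lv uv]|nLv] := boolP ((L v != set0) && untried L w v); last first.
    exists set0; rewrite sub0set eqxx big_set0; split=> //.
    by rewrite mulr_ge0 // (le_trans _ D'le) // addr_ge0 ?mulr_ge0.
  have [kept_ge excess degs] := good v Lv.
  have l'k := l'le _ kept_ge.
  have [|B [Bk cardB sumB _]] :=
      subset_small_average (f := f v) (D := D') (fun c => ler0n R _) l'k.
    apply: (@le_trans _ _ (\sum_(c in kept e L w v)
       ((1 - p) ^+ l * (#|colour_nbrs e L v c|%:R - D)
          + ((1 - p) ^+ l * D + s)))).
      apply: ler_sum => c; rewrite inE => /andP[cv _].
      by apply: le_trans (degs c cv) _; rewrite mulrBr; lra.
    rewrite big_split /= -mulr_sumr sumr_const -[_ *+ _]mulr_natr.
    set k := #|kept e L w v|%:R : R.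
    have lk : l%:R <= 2 * k.
      by rewrite -natrM ler_nat mul2n (leq_trans ll') // leq_double.
    have k0 : 0 <= k by [].
    have h1 : (1 - p) ^+ l * (\sum_(c in kept e L w v)
        (#|colour_nbrs e L v c|%:R - D)) <= 2 * s * k.
      apply: le_trans (ler_wpM2l q0 excess) _.
      apply: (@le_trans _ _ (1 * (s * l%:R))).
        by rewrite ler_wpM2r // mulr_ge0.
      by rewrite mul1r; nra.
    have h2 : ((1 - p) ^+ l * D + 3 * s) * k <= D' * k by rewrite ler_wpM2r.
    by move: h1 h2; lra.
  exists B; split=> //.
  by rewrite -card_gt0 cardB l'0.
have [L' L'P] := fin_all_exists choose.
have L'k v : L' v \subset kept e L w v by case: (L'P v).
have L'0 v : ~~ untried L w v -> L' v = set0.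
  case: (L'P v) => _ h _ _ /negbTE uv; apply/eqP/negbNE.
  by rewrite h uv andbF.
have deg_f v c : #|colour_nbrs e L' v c|%:R <= f v c.
  by rewrite ler_nat subset_leq_card // colour_nbrs_after_trials.
exists L'; last first.
  apply: (colour_after_trials e_sym cfw L'k) => v Lv uv.
  by case: (L'P v) => _ -> _ _; rewrite Lv.
split=> v; first by case: (L'P v).
  by case: (L'P v) => _ _ _; apply: le_trans; apply: ler_sum.
move=> c /(subsetP (L'k v)); rewrite inE => /andP[cv _].
exact: le_trans (deg_f v c) (le_trans (f_le v c) (deg_le v c cv)).
Qed.

End Rounds.

(** * Choice of the rates and of the scale *)

Section Scale.

Variable R : realType.

(** Parameters of the nibble when the surplus of the lists is measured by [a].
A round has trial rate [th] and tolerates deviations [sg * N]; the process stops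
when [D <= eta * N]; the tails are taken with exponential parameter [lam] and
have exponent [2 * gam * N]. The bound on [sg] makes the deviations small
compared to the decrease of [a * D] in a round with [eta * N <= D]. The last
condition makes the conflicts, of weight of order [th ^+ 2 * N / a], cheaper
than [gam * N]; as [gam] is only of order [th], it holds for small [th]. *)
Definition nibble_rates (a eta th sg lam gam : R) : Prop :=
  [/\ 0 < eta, eta <= 1 & 64 * 98 * eta <= a] /\
  [/\ 0 < th, 4 * th <= a, 0 <= sg & 14 * sg <= a * th * eta] /\
  [/\ 0 <= lam, lam <= 2^-1, 0 < gam,
      4 * lam ^+ 2 * th / a - lam * sg * a ^+ 2 / 2 <= - (2 * gam)
    & 16 * th ^+ 2 / a <= gam / 2].

Lemma nibble_rates_exist (a : R) : 0 < a -> a <= 1 ->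
  exists eta th sg lam gam : R, nibble_rates a eta th sg lam gam.
Proof.
move=> a0 a1.
pose eta := a / (64 * 98).
have eta0 : 0 < eta by rewrite divr_gt0 // mulr_gt0.
have eta1 : eta <= 1 by rewrite /eta ler_pdivrMr ?mulr_gt0 //; lra.
pose th := a ^+ 8 * eta ^+ 2 / (32 * (112 * 224)).
have th0 : 0 < th by rewrite !(mulr_gt0, exprn_gt0, invr_gt0).
(* For the value of [sg] chosen below, this [lam] minimises the exponent of the
   tails, and the minimum is [- (2 * gam)]. *)
pose lam := a ^+ 4 * eta / 224.
exists eta, th, (a * th * eta / 14), lam, (lam * th * a ^+ 3 * eta / 112).
have lam0 : 0 < lam by rewrite !(mulr_gt0, exprn_gt0, invr_gt0).
have a_neq0 : a != 0 by rewrite gt_eqF.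
split; [split=> //|split; split=> //].
- by rewrite /eta mulrC divfK // gt_eqF // mulr_gt0.
- have h : a ^+ 7 * eta ^+ 2 <= 1.
    by rewrite mulr_ile1 ?exprn_ge0 ?exprn_ile1 // ltW.
  have -> : 4 * th = a * (a ^+ 7 * eta ^+ 2 / (8 * (112 * 224))).
    by rewrite /th; field.
  rewrite ler_piMr ?(ltW a0) // ler_pdivrMr ?mulr_gt0 // mul1r.
  apply: le_trans h _; rewrite -[leLHS]mul1r ler_pM //; lra.
- by rewrite !(mulr_ge0, invr_ge0) // ltW.
- by rewrite mulrC divfK // pnatr_eq0.
- exact: ltW.
- have h : a ^+ 4 * eta <= 1.
    by rewrite mulr_ile1 ?exprn_ge0 ?exprn_ile1 // ltW.
  rewrite /lam ler_pdivrMr //; lra.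
- by rewrite !(mulr_gt0, exprn_gt0, invr_gt0).
- rewrite le_eqVlt; apply/orP; left; apply/eqP.
  by rewrite /lam; field.
- rewrite le_eqVlt; apply/orP; left; apply/eqP.
  by rewrite /th /lam; field.
Qed.

(** The last condition bounds the total weight of the deviation events met by
one of them, which is polynomial in [N] times [expR (- (gam * N))]. *)
Definition large_scale (a gam N : R) : Prop :=
  [/\ 2 <= N, 40 <= a * N, 64 * 98 * 2 <= a ^+ 3 * N, 4 <= gam * N
    & 24 * N ^+ 4 * expR (- (gam * N)) <= a ^+ 2 / 16].

Lemma large_scale_near (a gam : R) : 0 < a -> 0 < gam ->
  exists N0, forall N, N0 <= N -> large_scale a gam N.
Proof.
move=> a0 g0.
pose n1 := 40 / a; pose n2 := 64 * 98 * 2 / a ^+ 3; pose n3 := 4 / gam.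
pose n4 := 16 * 24 * 5 ^+ 5 / (a ^+ 2 * gam ^+ 5).
have a3 : 0 < a ^+ 3 by rewrite exprn_gt0.
have ag : 0 < a ^+ 2 * gam ^+ 5 by rewrite mulr_gt0 // exprn_gt0.
have n1_ge0 : 0 <= n1 by rewrite divr_ge0 // ltW.
have n2_ge0 : 0 <= n2 by rewrite divr_ge0 ?mulr_ge0 // ltW.
have n3_ge0 : 0 <= n3 by rewrite divr_ge0 // ltW.
have n4_ge0 : 0 <= n4 by rewrite divr_ge0 ?mulr_ge0 ?exprn_ge0 // ltW.
exists (2 + n1 + n2 + n3 + n4) => N hN.
have N2 : 2 <= N by lra.
have N0 : 0 < N by lra.
have below x y : 0 < y -> x / y <= N -> x <= y * N.
  by move=> y0; rewrite ler_pdivrMr // mulrC.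
split=> //.
- by apply: below; rewrite // -/n1; lra.
- by apply: below; rewrite // -/n2; lra.
- by apply: below; rewrite // -/n3; lra.
have h4 : 16 * 24 * 5 ^+ 5 <= a ^+ 2 * gam ^+ 5 * N.
  by apply: below; rewrite // -/n4; lra.
have gN0 : 0 < gam * N by rewrite mulr_gt0.
have := expR_ge_quintic (ltW gN0); set E := expR _ => hE.
rewrite expRN -/E ler_pdivrMr ?expR_gt0 //.
apply: le_trans (ler_wpM2l _ hE); last by rewrite divr_ge0 // exprn_ge0 // ltW.
rewrite expr_div_n mulf_div ler_pdivlMr ?mulr_gt0 ?exprn_gt0 //.
rewrite (_ : 24 * N ^+ 4 * _ = N ^+ 4 * (16 * 24 * 5 ^+ 5)); last by ring.
rewrite (_ : a ^+ 2 * _ = N ^+ 4 * (a ^+ 2 * gam ^+ 5 * N)); last by ring.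
by rewrite ler_wpM2l // exprn_ge0 // ltW.
Qed.

End Scale.

(** * The nibble *)

(** The surplus is required to exceed [a * D + a * N]: the part [a * D] decreases
with [D] and pays for the errors of each round, so that they do not accumulate,
and the part [a * N] is what remains for the last stage. *)
Definition nibble_state (R : realType) (V C : finType) (e : rel V) (a N : R)
    (l : nat) (D : R) (L : V -> {set C}) : Prop :=
  [/\ balanced e l D (2 * N / a) L, 0 <= D, D <= N,
      (1 + a) * D + a * N <= l%:R & l%:R <= 2 * N].

Lemma finish_nibble (R : realType) (a eta th sg lam gam N : R)
    (V C : finType) (e : rel V) (c0 : C) (l : nat) (D : R) (L : V -> {set C}) :
  0 < a -> nibble_rates a eta th sg lam gam -> large_scale a gam N ->
  symmetric e -> irreflexive e ->
  nibble_state e a N l D L -> D <= eta * N -> list_colourable e L.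
Proof.
move=> a0 rates N_large e_sym e_irr; case=> -[card_L sum_deg deg_le] D0 DN lD lN Deta.
have [[eta0 _ eta_a] _] := rates; have [N2 aN40 a3N _ _] := N_large.
have N0 : 0 < N by lra.
have aNl : a * N <= l%:R.
  have h : 0 <= (1 + a) * D by rewrite mulr_ge0 //; lra.
  lra.
apply: (list_colourable_of_long_lists e_sym e_irr card_L sum_deg deg_le c0).
- by rewrite -(ler_nat R); lra.
- apply: le_trans aNl.
  apply: (@le_trans _ _ (64 * 98 * (eta * N))); first by rewrite ler_wpM2l // mulr_ge0.
  by rewrite mulrA ler_wpM2r // ltW.
- apply: (@le_trans _ _ ((a * N) ^+ 2)); last first.
    by rewrite lerXn2r // nnegrE; lra.
  rewrite mulrA ler_pdivrMr //.
  have := ler_wpM2r (ltW N0) a3N; nra.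
Qed.

(** Both [l] and [D] drop by [th * D] up to errors of at most
[th ^+ 2 * D + 3 * s], with [s = sg * N]. As [4 * th <= a] and
[14 * s <= a * th * D], these are paid by the decrease of [a * D], which is
about [a * th * D]. *)
Lemma nibble_round (R : realType) (a eta th sg lam gam N : R)
    (V C : finType) (e : rel V) (l : nat) (D : R) (L : V -> {set C}) :
  0 < a -> a <= 4^-1 ->
  nibble_rates a eta th sg lam gam -> large_scale a gam N ->
  symmetric e -> irreflexive e ->
  nibble_state e a N l D L -> eta * N <= D ->
  exists (l' : nat) (D' : R) (L' : V -> {set C}),
    [/\ nibble_state e a N l' D' L', D' <= D - th * eta / 4 * N
      & list_colourable e L' -> list_colourable e L].
Proof.
set M := 2 * N / a.
move=> a0 a4 rates N_large e_sym e_irr; case=> bal D0 DN lD lN Deta.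
have [[eta0 eta1 _] [[th0 th_a sg0 sg_le] [lam0 lam2 gam0 tail_ok conf_ok]]]
  := rates.
have [N2 aN40 _ gamN _] := N_large.
have N0 : 0 < N by clear -N2; lra.
have aD0 : 0 <= a * D by rewrite mulr_ge0 // ltW.
have aNl : a * N <= l%:R by clear -aD0 D0 lD; lra.
have aN0 : 0 <= a * N by clear -aN40; lra.
have Dl : D <= l%:R by clear -aD0 aN0 lD; lra.
have l0 : 0 < l%:R :> R by clear -aNl aN40; lra.
have l_neq0 : l%:R != 0 :> R by rewrite gt_eqF.
have a_neq0 : a != 0 by rewrite gt_eqF.
have th1 : th <= 16^-1 by clear -th_a a4; lra.
have M0 : 0 < M by rewrite divr_gt0 // mulr_gt0.
have aM : a * M = 2 * N by rewrite mulrCA mulfV ?mulr1.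
have lM : l%:R <= M.
  apply: le_trans lN _; rewrite -[leLHS]aM ler_piMl ?(ltW M0) //; clear -a4; lra.
pose p := th / l%:R.
have pl : p * l%:R = th by rewrite divfK.
have p0 : 0 <= p by rewrite divr_ge0 // ltW.
have p1 : p <= 16^-1.
  by rewrite ler_pdivrMr //; clear -th1 aNl aN40; lra.
pose E := expR (- (gam * N)).
have E0 : 0 <= E by apply: expR_ge0.
(* [Y] bounds the deviation weight at one coordinate and [Z] the one met by a
   scope. *)
pose Z := M * l%:R * (M * (l%:R + 1) * E).
have Zle : Z <= 16^-1.
  have a2 : 0 < a ^+ 2 by rewrite exprn_gt0.
  have [_ _ _ _ exp_ok] := N_large.
  rewrite -(ler_pM2l a2); apply: le_trans exp_ok; rewrite -/E.
  have -> : a ^+ 2 * Z = (a * M) ^+ 2 * (l%:R * (l%:R + 1)) * E.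
    by rewrite /Z; ring.
  rewrite aM ler_wpM2r //.
  have h : l%:R * (l%:R + 1) <= 2 * N * (3 * N).
    by rewrite ler_pM ?addr_ge0 ?(ltW l0) //; clear -lN N2; lra.
  rewrite (_ : 24 * N ^+ 4 = (2 * N) ^+ 2 * (2 * N * (3 * N))); last by ring.
  by rewrite ler_wpM2l // sqr_ge0.
have l1 : 1 <= l%:R :> R by clear -aNl aN40; lra.
have M1 : 1 <= M by exact: le_trans lM.
pose Y := M * (l%:R + 1) * E.
have l1M : 1 <= M * (l%:R + 1) by rewrite mulr_ege1 //; clear -l1; lra.
have EY : E <= Y by rewrite ler_peMl.
have YZ : Y <= Z.
  rewrite -[Z]/(M * l%:R * Y) ler_peMl //; last exact: mulr_ege1.
  exact: le_trans EY.
have p2 : p ^+ 2 <= 16^-1.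
  by rewrite -[leRHS]mulr1 expr2 ler_pM //; clear -p1; lra.
have p2M : 128 * (p ^+ 2 * M) <= 1.
  have p2M0 : 0 <= p ^+ 2 * M by rewrite mulr_ge0 ?sqr_ge0 ?ltW.
  have a3N : 128 <= a ^+ 3 * N by have [_ _ h _ _] := N_large; clear -h; lra.
  apply: le_trans (ler_wpM2r p2M0 a3N) _.
  have -> : a ^+ 3 * N * (p ^+ 2 * M) = p ^+ 2 * (a ^+ 2 * N * (a * M)) by ring.
  rewrite aM.
  have -> : p ^+ 2 * (a ^+ 2 * N * (2 * N)) = 2 * (p * (a * N)) ^+ 2 by ring.
  have h : p * (a * N) <= 16^-1.
    by apply: le_trans th1; rewrite -pl ler_wpM2l.
  have h0 : 0 <= p * (a * N) by rewrite mulr_ge0.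
  by move: h h0; set x := p * _; clear => h h0; nra.
pose s := sg * N.
have s0 : 0 <= s by rewrite mulr_ge0 // ltW.
have tail : 2 * lam ^+ 2 * (p * l%:R * M) - lam * s * l%:R / M
    <= - (2 * (gam * N)).
  have lM2 : a ^+ 2 / 2 <= l%:R / M.
    have -> : a ^+ 2 / 2 = a * N / M by rewrite /M; field; rewrite a_neq0 gt_eqF.
    by rewrite ler_pM2r ?invr_gt0.
  have h1 : lam * s * (a ^+ 2 / 2) <= lam * s * (l%:R / M).
    by rewrite ler_wpM2l // mulr_ge0.
  have h2 := ler_wpM2r (ltW N0) tail_ok.
  have -> : 2 * lam ^+ 2 * (p * l%:R * M) = 4 * lam ^+ 2 * th / a * N.
    by rewrite pl /M; ring.
  have -> : lam * s * l%:R / M = lam * s * (l%:R / M) by rewrite -!mulrA.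
  apply: le_trans (_ : _ <= 4 * lam ^+ 2 * th / a * N - lam * s * (a ^+ 2 / 2)) _.
    by rewrite lerD2l lerN2.
  rewrite (_ : - (2 * (gam * N)) = - (2 * gam) * N); last by ring.
  by apply: le_trans h2; rewrite /s le_eqVlt; apply/orP; left; apply/eqP; ring.
have conf : 8 * p ^+ 2 * (M * D * l%:R) <= gam * N / 2.
  have pD : p * D <= th by rewrite -pl ler_wpM2l.
  have -> : 8 * p ^+ 2 * (M * D * l%:R) = 8 * M * th * (p * D).
    by rewrite -pl; ring.
  apply: le_trans (_ : _ <= 8 * M * th * th) _.
    by rewrite ler_wpM2l // mulr_ge0 ?(ltW th0) // mulr_ge0 // ltW.
  have := ler_wpM2r (ltW N0) conf_ok.
  have -> : 8 * M * th * th = 16 * th ^+ 2 / a * N by rewrite /M; ring.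
  by move=> h; clear -h; lra.
pose y := th * D + s.
pose t := Num.truncn y.
have u0 : 0 <= th * D by rewrite mulr_ge0 // ltW.
have y0 : 0 <= y by rewrite addr_ge0.
have ty : t%:R <= y by rewrite truncn_le.
have s_le : 14 * s <= a * (th * D).
  apply: le_trans (_ : _ <= a * th * eta * N) _.
    by rewrite /s mulrA ler_wpM2r // ltW.
  rewrite -!mulrA ler_wpM2l ?(ltW a0) // ler_wpM2l ?(ltW th0) //.
have au : a * (th * D) <= 4^-1 * (th * D) by rewrite ler_wpM2r.
have uD : th * D <= 16^-1 * D by rewrite ler_wpM2r.
have yl : y <= 2^-1 * l%:R by rewrite /y; clear -s_le au uD Dl u0 D0; lra.
have tl : (t <= l)%N by rewrite -(ler_nat R); clear -ty yl l0; lra.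
(* Subtracting the integer part of the loss [y] is a safe rounding: the
   number of deleted colours is an integer, so it is at most [t] as soon as it
   is at most [y]. *)
pose l' := (l - t)%N.
have l'E : l'%:R = l%:R - t%:R :> R by rewrite natrB.
pose D' := D - th * D + th * (th * D) + 3 * s.
have w_le : th * (th * D) <= a / 4 * (th * D) by rewrite ler_wpM2r //; clear -th_a; lra.
have w0 : 0 <= th * (th * D) by rewrite mulr_ge0 // ltW.
have D'0 : 0 <= D' by rewrite /D'; clear -uD w0 s0 D0; lra.
have t0 : 0 <= t%:R :> R by [].
have ll' : (l <= l'.*2)%N.
  by rewrite -(ler_nat R) -mul2n natrM l'E; clear -yl ty; lra.
have l'0 : (0 < l')%N.
  by rewrite -double_gt0 (leq_trans _ ll') // -(ltr_nat R).
have l'le (n : nat) : l%:R - p * D * l%:R - s <= n%:R -> (l' <= n)%N.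
  rewrite mulrAC pl => hn; have hy : l%:R - n%:R <= y by rewrite /y; clear -hn; lra.
  rewrite leq_subLR addnC -leq_subLR; have [ln|nl] := leqP l n.
    by rewrite (eqP ln).
  by rewrite truncn_ge_nat // natrB // ltnW.
have p1' : p <= 1 by clear -p1; lra.
have D'le : (1 - p) ^+ l * D + 3 * s <= D'.
  have q_le : (1 - p) ^+ l <= 1 - th + th * th.
    apply: le_trans (exprn_1subr_le _ p0 p1') _; rewrite pl.
    have th3 : 0 <= th * th * th by rewrite !mulr_ge0 ?(ltW th0).
    rewrite -[leLHS]mul1r ler_pdivrMr; clear -th3 th0; last by lra.
    by rewrite mulrDr mulr1 !mulrDl mul1r mulNr; lra.
  rewrite /D' lerD2r; apply: le_trans (ler_wpM2r D0 q_le) _.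
  by rewrite !mulrDl mul1r mulNr mulrA.
have DM : D <= M by apply: le_trans lM.
have p2' : 2 * p ^+ 2 <= 2^-1 by clear -p2; lra.
have Y16 : Y <= 16^-1 by apply: le_trans Zle.
have E2 : E <= 2^-1.
  by apply: le_trans EY (le_trans Y16 _); clear; lra.
have conf' : 2 * (8 * p ^+ 2 * M + 2 * Y) <= 2^-1.
  by rewrite -[8 * p ^+ 2 * M]mulrA; move: p2M Y16; clear => h1 h2; lra.
have beats : 1 + 8 * p ^+ 2 * (M * D * l%:R) + 2 * Z <= gam * N.
  by move: conf Zle gamN; clear => h1 h2 h3; lra.
have [L' balL' colL'] := colouring_round e_sym e_irr bal p0 p1' D0 DM lM M0
  lam0 lam2 s0 tail p2' E2 conf' beats l'0 ll' l'le D'le.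
have etaD : th * eta / 4 * N <= 4^-1 * (th * D).
  have := ler_wpM2l (ltW th0) Deta; rewrite mulrA.
  by move=> h; clear -h; lra.
have D'_drop : D' <= D - th * eta / 4 * N.
  by rewrite /D'; clear -etaD s_le au w_le w0 u0; lra.
exists l', D', L'; split=> //; split=> //.
- have h : 0 <= th * eta / 4 * N.
    by rewrite !mulr_ge0 ?invr_ge0 // ltW.
  by clear -h D'_drop DN; lra.
- have aw : a * (th * (th * D)) <= 4^-1 * (th * (th * D)) by rewrite ler_wpM2r.
  have as_le : a * s <= 4^-1 * s by rewrite ler_wpM2r.
  rewrite l'E; move: ty lD; rewrite /D' /y.
  by clear -aw as_le s_le w_le w0 s0 u0; lra.
- by rewrite l'E; clear -t0 lN; lra.
Qed.

(** * Conclusion *)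

(** Each round lowers [D] by at least the fixed amount [th * eta / 4 * N], so
finitely many rounds reach the last stage. *)
Lemma nibble_colourable (R : realType) (a eta th sg lam gam N : R)
    (V C : finType) (e : rel V) (c0 : C) :
  0 < a -> a <= 4^-1 ->
  nibble_rates a eta th sg lam gam -> large_scale a gam N ->
  symmetric e -> irreflexive e ->
  forall (l : nat) (D : R) (L : V -> {set C}),
    nibble_state e a N l D L -> list_colourable e L.
Proof.
move=> a0 a4 rates N_large e_sym e_irr l D L st.
have [[eta0 _ _] [[th0 _ _ _] _]] := rates.
have N0 : 0 < N by have [N2 _ _ _ _] := N_large; lra.
pose drop := th * eta / 4 * N.
have drop0 : 0 < drop by rewrite !mulr_gt0 ?invr_gt0.
have [n] : exists n : nat, D <= eta * N + n%:R * drop.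
  exists (Num.truncn (D / drop)).+1.
  have := truncnS_gt (D / drop); rewrite ltr_pdivrMr // => /ltW h.
  by apply: le_trans h _; rewrite lerDr ltW // mulr_gt0.
have finish := finish_nibble c0 a0 rates N_large e_sym e_irr.
elim: n l D L st => [|n IHn] l D L st Dn.
  by apply: finish st _; rewrite mul0r addr0 in Dn.
have [De|De] := leP D (eta * N); first exact: finish st De.
have [l' [D' [L' [st' D'le]]]] :=
  nibble_round a0 a4 rates N_large e_sym e_irr st (ltW De).
apply; apply: IHn st' _; apply: le_trans D'le _.
by rewrite -/drop lerBlDr; move: Dn; rewrite -natr1 mulrDl mul1r addrA.
Qed.

(** The surplus is at least [4 * a * N]. Lists of length about
[(1 + 2 * a) * N] still satisfy the invariant for [D = N], and the discarded
proportion, at least [a / 2], bounds all remaining degrees by [2 * N / a]. *)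
Lemma list_colourable_average (R : realType) (eps : R) : 0 < eps ->
  exists2 N0 : R, 0 < N0 & forall N : R, N0 <= N ->
    forall (V C : finType) (e : rel V) (L : V -> {set C}),
      symmetric e -> irreflexive e ->
      (forall v, (1 + eps) * N <= #|L v|%:R) ->
      (forall v, \sum_(c in L v) #|colour_nbrs e L v c|%:R <= N * #|L v|%:R) ->
      exists phi : V -> C,
        (forall v, phi v \in L v) /\ (forall u v, e u v -> phi u != phi v).
Proof.
move=> eps0.
pose a := Num.min eps 1 / 4.
have min0 : 0 < Num.min eps 1 by rewrite lt_min eps0 ltr01.
have min_eps : Num.min eps 1 <= eps by rewrite ge_min lexx.
have min1 : Num.min eps 1 <= 1 by rewrite ge_min lexx orbT.
have a0 : 0 < a by rewrite divr_gt0.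
have a4 : a <= 4^-1 by rewrite /a; lra.
have a_eps : 4 * a <= eps by rewrite /a; lra.
have [|eta [th [sg [lam [gam rates]]]]] := nibble_rates_exist a0; first by lra.
have gam0 : 0 < gam by case: rates => _ [_ []].
have [N0 large] := large_scale_near a0 gam0.
exists (Num.max N0 1) => [|N hN V C e L e_sym e_irr L_ge sum_deg].
  by rewrite lt_max ltr01 orbT.
have N_large : large_scale a gam N.
  by apply: large; apply: le_trans hN; rewrite le_max lexx.
have [N2 aN40 _ _ _] := N_large.
have N_gt0 : 0 < N by lra.
have [v0 _|V0] := pickP (predT : pred V); last first.
  have phi (v : V) : C by have := V0 v.
  by exists phi; split=> v; have := V0 v.
have L_gt0 v : 0 < #|L v|%:R :> R.
  by apply: lt_le_trans (L_ge v); rewrite mulr_gt0 //; lra.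
have [c0 _] : exists c0, c0 \in L v0.
  by apply/card_gt0P; rewrite -(ltr_nat R).
pose k := (Num.truncn ((1 + 2 * a) * N)).+1.
have aN2 : 0 <= a * N by lra.
have k_ge : (1 + 2 * a) * N <= k%:R by apply/ltW/truncnS_gt.
have k_le : k%:R <= (1 + 2 * a) * N + 1.
  by rewrite /k -natr1 lerD2r truncn_le // mulr_ge0 //; lra.
have kL v : k%:R <= #|L v|%:R * (1 - a / 2).
  apply: le_trans k_le _.
  apply: (@le_trans _ _ ((1 + 4 * a) * N * (1 - a / 2))).
    have aaN : a * (a * N) <= 4^-1 * (a * N) by rewrite ler_wpM2r.
    nra.
  rewrite ler_wpM2r //; first by lra.
  apply: le_trans (L_ge v); rewrite ler_wpM2r //; lra.
have trunc v : exists B : {set C}, [/\ B \subset L v, #|B| = k,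
     \sum_(c in B) #|colour_nbrs e L v c|%:R <= N * k%:R
   & forall c, c \in B -> #|colour_nbrs e L v c|%:R <= 2 * N / a].
  have kLv := kL v; have Lv0 := L_gt0 v.
  have [||B [BL cardB sumB degB]] := subset_small_average
     (f := fun c => #|colour_nbrs e L v c|%:R) (k := k) _ _ (sum_deg v).
  - by move=> c.
  - by rewrite -(ler_nat R); nra.
  exists B; split=> // c cB; have := degB c cB.
  set d := #|_|%:R; have d0 : 0 <= d by [].
  set x := #|L v|%:R in kLv Lv0 *; move=> h.
  rewrite ler_pdivlMr //.
  have h1 : d * (x * (a / 2)) <= N * x.
    by apply: le_trans h; rewrite ler_wpM2l //; lra.
  rewrite -(ler_pM2r Lv0); lra.
have [L0 L0P] := fin_all_exists trunc.
have L0L v : L0 v \subset L v by case: (L0P v).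
have nbrs v c : #|colour_nbrs e L0 v c|%:R <= #|colour_nbrs e L v c|%:R :> R.
  rewrite ler_nat subset_leq_card //; apply/subsetP => u; rewrite !inE.
  by move=> /andP[->]; apply: (subsetP (L0L u)).
have L0n v : L0 v != set0 by case: (L0P v) => _ h _ _; rewrite -card_gt0 h.
have [phi [phiL phie]] : list_colourable e L0.
  apply: (nibble_colourable c0 a0 a4 rates N_large e_sym e_irr
            (l := k) (D := N)).
  split=> //; [split=> v|exact: ltW| |].
  - by case: (L0P v).
  - by case: (L0P v) => _ _ + _; apply: le_trans; apply: ler_sum.
  - by move=> c cv; case: (L0P v) => _ _ _ /(_ c cv); apply: le_trans.
  - by apply: le_trans k_ge; lra.
  - apply: le_trans k_le _; have : a * N <= 4^-1 * N by rewrite ler_wpM2r // ltW.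
    by lra.
exists phi; split=> [v|u v euv]; first by apply: (subsetP (L0L v)); apply: phiL.
exact: phie.
Qed.

Local Open Scope fset_scope.
Local Open Scope ring_scope.

Theorem theorem1p3 (R : realType) (eps : R) (eps_gt0 : 0 < eps) :
  exists D0 : R, forall D : R, D0 <= D ->
    forall (V : finType) (e : rel V) (C : choiceType) (L : V -> {fset C}),
      simple_graph e ->
      (forall v : V, average_colour_degree R e L v <= D) ->
      (forall v : V, (1 + eps) * D <= #|` L v|%:R) ->
      exists phi : V -> C, proper_list_colouring e L phi.
Proof.
have [N0 N0_gt0 colourable] := list_colourable_average eps_gt0.
exists N0 => D N0D V e C L [e_sym e_irr] avg L_ge.
(* Only the finitely many colours of the lists matter, which gives a finite
   type of colours. *)
pose U : {fset C} := seq_fset tt (flatten [seq enum_fset (L v) | v <- enum V]).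
have LU v c : c \in L v -> c \in U.
  move=> cv; rewrite seq_fsetE; apply/flattenP; exists (enum_fset (L v)) => //.
  by apply: map_f; rewrite mem_enum.
pose L' v : {set U} := [set c : U | val c \in L v].
have L'perm v : perm_eq (L v) [seq val c | c <- enum (L' v)].
  apply: uniq_perm; rewrite ?fset_uniq ?(map_inj_uniq val_inj) ?enum_uniq // => c.
  apply/idP/mapP => [cv|[d]]; last by rewrite mem_enum inE => dv ->.
  by exists [` LU v c cv]; rewrite // mem_enum inE.
have nbrs v (c : U) : #|colour_nbrs e L' v c| = vertex_colour_degree e L v (val c).
  by apply: eq_card => u; rewrite !inE.
have card_L' v : #|L' v| = #|` L v|.
  by rewrite (perm_size (L'perm v)) size_map -cardE.
have D_gt0 : 0 < D by apply: lt_le_trans N0D.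
have [||phi [phiL phie]] := colourable D N0D V U e L' e_sym e_irr.
- by move=> v; rewrite card_L'.
- move=> v; rewrite card_L'.
  have L_gt0 : 0 < #|` L v|%:R :> R.
    by apply: lt_le_trans (L_ge v); rewrite mulr_gt0 // addr_gt0.
  have := avg v; rewrite /average_colour_degree mulrC ler_pdivrMr //.
  rewrite (perm_big _ (L'perm v)) big_map big_enum /=.
  by apply: le_trans; apply: ler_sum => c _; rewrite nbrs.
exists (val \o phi); split=> [v|u v euv] /=.
  by have := phiL v; rewrite inE.
by move/val_inj => eq_phi; have := phie u v euv; rewrite eq_phi eqxx.
Qed.
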